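(* Let $(M,d)$ be a complete pointed metric space with base point $0$. Let $\mu$ be a positive Radon measure on $\beta\widetilde{M}$ which is an optimal representation (i.e. $\|\mu\|=\|\Phi^*\mu\|$), which is $\preccurlyeq$-minimal, and which satisfies $\Phi^*\mu\in\mathcal{F}(M)$. Then $\mu$ is concentrated on $p^{-1}(M\times M)$.
   Context: $\mathrm{Lip}_0(M)$ is the Banach space of Lipschitz $f:M\to\mathbb{R}$ with $f(0)=0$, normed by the Lipschitz constant; $\mathcal{F}(M)\subset\mathrm{Lip}_0(M)^*$ is the closed linear span of the evaluation functionals $\delta(x)$, $x\in M$. $\widetilde{M}=\{(x,y)\in M\times M:x\neq y\}$, $\beta\widetilde{M}$ is its Stone–Čech compactification, and Radon measures on $\beta\widetilde{M}$ are identified with $C(\beta\widetilde{M})^*$. $\Phi:\mathrm{Lip}_0(M)\to C(\beta\widetilde{M})$ sends $f$ to the continuous extension of $(x,y)\mapsto (f(x)-f(y))/d(x,y)$, and $\Phi^*$ is its adjoint. $M^u$ is the uniform (Samuel) compactification of $M$; $p_1,p_2:\beta\widetilde{M}\to M^u$ are the continuous extensions of $(x,y)\mapsto x$, $(x,y)\mapsto y$, and $p=(p_1,p_2)$. Let $G$ be the set of $g\in C(\beta\widetilde{M})$ such that $d(x,y)g(x,y)\le d(x,u)g(x,u)+d(u,y)g(u,y)$ for all distinct $x,u,y\in M$. For positive Radon measures $\mu,\nu$ on $\beta\widetilde{M}$ write $\mu\preccurlyeq\nu$ if $\int g\,d\mu\le\int g\,d\nu$ for all $g\in G$; $\mu$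 is $\preccurlyeq$-minimal if every positive $\nu$ with $\nu\preccurlyeq\mu$ also satisfies $\mu\preccurlyeq\nu$. Throughout, $M$ is assumed to have at least three distinct points. *)

(* Defs.v *)
From HB Require Import structures.
From mathcomp Require Import all_boot all_order all_algebra.
From mathcomp Require Import all_classical all_reals all_analysis.
Set Implicit Arguments. Unset Strict Implicit. Unset Printing Implicit Defensive.
Import Order.TTheory GRing.Theory Num.Theory.
Import numFieldNormedType.Exports.
Local Open Scope classical_set_scope.
Local Open Scope ring_scope.

Section MetricDefs.
Variables (R : realType) (T : Type) (d : T -> T -> R).

Definition is_metric : Prop :=
  [/\ (forall x y, d x y = 0 <-> x = y),
      (forall x y, d x y = d y x) &
      (forall x y z, d x z <= d x y + d y z)].

Definition complete_metric : Prop :=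
  forall u : nat -> T,
    (forall e : R, 0 < e -> exists N, forall m n, (N <= m)%N -> (N <= n)%N ->
        d (u m) (u n) < e) ->
    exists l, forall e : R, 0 < e -> exists N, forall n, (N <= n)%N -> d (u n) l < e.

Definition is_lipschitz (f : T -> R) : Prop :=
  exists L : R, forall x y, `|f x - f y| <= L * d x y.

Definition lip_le1 (f : T -> R) : Prop := forall x y, `|f x - f y| <= d x y.

Definition Lip0 (x0 : T) (f : T -> R) : Prop := f x0 = 0 /\ is_lipschitz f.

Definition Lip0_ball (x0 : T) : set (T -> R) :=
  [set f | f x0 = 0 /\ lip_le1 f].

Definition bounded_fun (f : T -> R) : Prop := exists C : R, forall x, `|f x| <= C.

Definition unif_cont (f : T -> R) : Prop :=
  forall e : R, 0 < e -> exists2 del : R, 0 < del &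
    forall x y, d x y < del -> `|f x - f y| < e.

(* functions on Mtilde = {(x,y) : x <> y}, represented as curried maps *)
Definition bounded_on_tilde (g : T -> T -> R) : Prop :=
  exists C : R, forall x y, x <> y -> `|g x y| <= C.

Definition cont_on_tilde (g : T -> T -> R) : Prop :=
  forall x y, x <> y -> forall e : R, 0 < e -> exists2 del : R, 0 < del &
    forall x' y', x' <> y' -> d x x' < del -> d y y' < del -> `|g x' y' - g x y| < e.

(* (K, iota) is the Stone-Cech compactification of Mtilde (with the topology
   induced by the metric of M x M), characterised as the (compact Hausdorff)
   compactification, with continuous dense map, to which every bounded
   continuous real function on Mtilde extends continuously. *)
Definition is_stone_cech_tilde (K : ptopologicalType) (iota : T -> T -> K) : Prop :=
  [/\ hausdorff_space K, compact [set: K],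
      (forall x y, x <> y -> forall V, nbhs (iota x y) V ->
          exists2 del : R, 0 < del & forall x' y', x' <> y' -> d x x' < del ->
              d y y' < del -> V (iota x' y')),
      closure [set z | exists x y, x <> y /\ z = iota x y] = [set: K] &
      (forall g : T -> T -> R, bounded_on_tilde g -> cont_on_tilde g ->
          exists h : K -> R, continuous h /\ forall x y, x <> y -> h (iota x y) = g x y)].

(* (U, j) is the uniform (Samuel) compactification of M: a compact Hausdorff
   space with a continuous dense map j such that the real functions on M of the
   form h \o j, h in C(U), are exactly the bounded uniformly continuous ones. *)
Definition is_uniform_compactification (U : ptopologicalType) (j : T -> U) : Prop :=
  [/\ hausdorff_space U /\ compact [set: U],
      (forall x V, nbhs (j x) V -> exists2 del : R, 0 < del &
          forall y, d x y < del -> V (j y)),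
      closure (range j) = [set: U],
      (forall f : T -> R, bounded_fun f -> unif_cont f ->
          exists h : U -> R, continuous h /\ forall x, h (j x) = f x) &
      (forall h : U -> R, continuous h -> unif_cont (h \o j))].

End MetricDefs.

Notation borel K := (g_sigma_algebraType (@open K)).

Section MeasureDefs.
Variables (R : realType) (K : ptopologicalType).
Local Open Scope ereal_scope.

Definition radon (mu : {measure set (borel K) -> \bar R}) : Prop :=
  mu [set: borel K] < +oo /\
  forall A : set (borel K), measurable A ->
    mu A = ereal_sup [set mu C | C in [set C : set (borel K) | compact (C : set K) /\ C `<=` A]].

Definition integ (mu : {measure set (borel K) -> \bar R}) (g : K -> R) : \bar R :=
  \int[mu]_(z in [set: borel K]) (g z)%:E.

End MeasureDefs.

Section GDefs.
Variables (R : realType) (T : Type) (d : T -> T -> R) (K : ptopologicalType)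
  (iota : T -> T -> K).
Local Open Scope ereal_scope.

Definition Gset : set (K -> R) :=
  [set g | continuous g /\
     forall x u y, x <> u -> u <> y -> x <> y ->
       (d x y * g (iota x y) <= d x u * g (iota x u) + d u y * g (iota u y))%R].

Definition preceq (mu nu : {measure set (borel K) -> \bar R}) : Prop :=
  forall g, Gset g -> integ mu g <= integ nu g.

Definition preceq_minimal (mu : {measure set (borel K) -> \bar R}) : Prop :=
  forall nu : {measure set (borel K) -> \bar R}, radon nu -> preceq nu mu -> preceq mu nu.

End GDefs.

(* Main.v *)
(** The measure is minimal for integration against the cone G, so Hahn-Banach and the Riesz
    representation theorem show that, for a Borel weight 0 <= m <= 1 and g0 in G, the infimum of
    int m (g + g0) d mu over g in G with g >= - g0 is 0. By inf-convolution it is enough to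
    look at slopes of Lipschitz functions h with values in [-1, 0]; applied to
    g0 = 1 / (a + d), a lower bound - c of int m slope(h) d mu over such h bounds
    int m / (a + d) d mu by c for every a > 0.

    Membership of Phi^* mu in F(M) yields finite sets L_n such that int slope(f) d mu is small
    for Lipschitz f vanishing on L_n. Let w_n = min (1, d(., L_n)), let W1 and W2 be the limits of
    the extensions of w_n(x) and w_n(y) to beta Mtilde, and take m = (W1^2 + W2^2) / 2. Writing
    1 / d for the limit of 1 / (a + d), the Leibniz rule for slope (w_n^2 h) first gives
    int m / d < oo, then int m slope(h) >= - int W2^2 / (2 d), hence int W1^2 / d = 0, and with
    h = -1 also int W2^2 / d = 0. Optimality of mu excludes d = oo, so W1 = W2 = 0 almost
    everywhere, and by
    completeness of M both coordinates of a point where W1 = W2 = 0 lie in M. *)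
Require Import Defs.
From HB Require Import structures.
From mathcomp Require Import all_boot all_order all_algebra.
From mathcomp Require Import all_classical all_reals all_analysis.
From mathcomp Require Import measurable_realfun ring lra.
Set Implicit Arguments. Unset Strict Implicit. Unset Printing Implicit Defensive.
Import Order.TTheory GRing.Theory Num.Theory.
Import numFieldNormedType.Exports.
Local Open Scope classical_set_scope.
Local Open Scope ring_scope.

(** The weight m is forced: it is the limit of the coefficient of slope(h) in the symmetric Leibniz
    rule for slope(w_n^2 h). Being only a pointwise limit, it is known to be Borel but not
    continuous, so minimality has to be exploited with Borel weights. Squaring w_n makes
    slope(w_n^2) tend to 0 wherever W1 = W2 = 0, even at distance 0. The obstacle is that 1 / d is
    unbounded and that slope(h) is no quotient where d = 0. The crude bound int m / d < oo serves
    twice. It shows that m vanishes almost everywhere on d = 0. It also permits a cancellation: with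
    I_i = int W_i^2 / (2 d), the sharper bound reads I_1 + I_2 = int m / d <= I_2, which yields I_1
    = 0 only because I_2 is finite. The asymmetry between the two coordinates comes from the range
    [-1, 0] of h: h <= 0 because the inf-convolution may use the point itself, and h >= -1 because d
    g >= - d g0 = - d / (a + d) >= -1. *)

(** * Hahn-Banach theorem for a sublinear functional on a subspace *)

Section HahnBanach.
Context {R : realType} {V : lmodType R}.
Implicit Types (S : set V) (p q : V -> R).

Definition linear_subspace S :=
  [/\ S 0, (forall x y, S x -> S y -> S (x + y)) & (forall a x, S x -> S (a *: x))].

Definition sublinear_on S p :=
  (forall x y, S x -> S y -> p (x + y) <= p x + p y) /\
  (forall (a : R) x, 0 <= a -> S x -> p (a *: x) <= a * p x).

Definition linear_on S p :=
  (forall x y, S x -> S y -> p (x + y) = p x + p y) /\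
  (forall (a : R) x, S x -> p (a *: x) = a * p x).

Lemma sublinear_on0 S p : linear_subspace S -> sublinear_on S p -> p 0 = 0.
Proof.
move=> [S0 _ _] [pD pZ]; apply/eqP; rewrite eq_le; apply/andP; split.
  by have := pZ 0 0 (lexx _) S0; rewrite scale0r mul0r.
by have := pD 0 0 S0 S0; rewrite addr0; lra.
Qed.

Lemma sublinear_onZ S p a x : linear_subspace S -> sublinear_on S p ->
  0 <= a -> S x -> p (a *: x) = a * p x.
Proof.
move=> lS sp; rewrite le_eqVlt => /orP[/eqP<- _|a0 Sx].
  by rewrite scale0r mul0r (sublinear_on0 lS sp).
have [S0 SD SZ] := lS; have [pD pZ] := sp.
apply/eqP; rewrite eq_le pZ ?(ltW a0)//=.
have ai : 0 <= a^-1 by rewrite invr_ge0 ltW.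
have := pZ a^-1 (a *: x) ai (SZ _ _ Sx).
rewrite scalerA mulVf ?gt_eqF// scale1r.
by rewrite ler_pdivlMl.
Qed.

Lemma sublinear_onN S p x : linear_subspace S -> sublinear_on S p ->
  S x -> - p (- x) <= p x.
Proof.
move=> lS sp Sx; have [S0 SD SZ] := lS; have [pD _] := sp.
have SNx : S (- x) by rewrite -scaleN1r; exact: SZ.
by have := pD _ _ Sx SNx; rewrite subrr (sublinear_on0 lS sp); lra.
Qed.

(** For [p] sublinear, this is the largest sublinear minorant of [p] whose value at [- y] is at most
    [- p y], that is, which is linear along [y]. *)
Definition directional_inf p y : V -> R :=
  fun x => inf [set p (x + t *: y) - t * p y | t in [set t : R | 0 <= t]].

Lemma directional_inf_lb S p y x : linear_subspace S -> sublinear_on S p ->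
  S x -> S y -> forall t, 0 <= t -> - p (- x) <= p (x + t *: y) - t * p y.
Proof.
move=> lS sp Sx Sy t t0; have [S0 SD SZ] := lS; have [pD _] := sp.
have SNx : S (- x) by rewrite -scaleN1r; exact: SZ.
have := pD (x + t *: y) (- x) (SD _ _ Sx (SZ _ _ Sy)) SNx.
rewrite addrAC subrr add0r (sublinear_onZ lS sp)//; lra.
Qed.

Lemma directional_inf_le S p y x : linear_subspace S -> sublinear_on S p ->
  S x -> S y -> forall t, 0 <= t ->
  directional_inf p y x <= p (x + t *: y) - t * p y.
Proof.
move=> lS sp Sx Sy t t0; apply: ge_inf; last by exists t.
exists (- p (- x)) => _ [s /= s0 <-]; exact: (directional_inf_lb lS sp).
Qed.

Lemma le_directional_inf p y x c :
  (forall t, 0 <= t -> c <= p (x + t *: y) - t * p y) ->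
  c <= directional_inf p y x.
Proof.
move=> h; apply: lb_le_inf; first by eexists; exists 0 => //=.
by move=> _ [t /= t0 <-]; exact: h.
Qed.

Lemma directional_inf_le_id S p y x : linear_subspace S -> sublinear_on S p ->
  S x -> S y -> directional_inf p y x <= p x.
Proof.
move=> lS sp Sx Sy.
by have := directional_inf_le lS sp Sx Sy (lexx 0); rewrite scale0r mul0r addr0 subr0.
Qed.

Lemma directional_inf_sublinear S p y : linear_subspace S -> sublinear_on S p ->
  S y -> sublinear_on S (directional_inf p y).
Proof.
move=> lS sp Sy; have [S0 SD SZ] := lS; have [pD _] := sp.
split=> [x1 x2 Sx1 Sx2|a x a0 Sx].
  rewrite -lerBlDr; apply: le_directional_inf => t t0.
  rewrite lerBlDr -lerBlDl; apply: le_directional_inf => s s0.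
  rewrite lerBlDl.
  have /le_trans-> // := directional_inf_le lS sp (SD _ _ Sx1 Sx2) Sy (addr_ge0 t0 s0).
  have := pD _ _ (SD _ _ Sx1 (SZ t _ Sy)) (SD _ _ Sx2 (SZ s _ Sy)).
  rewrite addrACA -scalerDl mulrDl; lra.
move: a0; rewrite le_eqVlt => /orP[/eqP<-|a0].
  rewrite scale0r mul0r (le_trans (directional_inf_le_id lS sp S0 Sy))//.
  by rewrite (sublinear_on0 lS sp).
rewrite -ler_pdivrMl//; apply: le_directional_inf => t t0.
rewrite ler_pdivrMl//.
have /le_trans-> // := directional_inf_le lS sp (SZ a _ Sx) Sy (mulr_ge0 (ltW a0) t0).
rewrite -scalerA -scalerDr (sublinear_onZ lS sp (ltW a0)) ?mulrBr ?mulrA//.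
by apply: SD => //; exact: SZ.
Qed.

(** Minimality against [directional_inf p y], which at [x] is at most [p (x + y) - p y] (the case t
    = 1), gives superadditivity. Additivity then settles negative scalars. *)
Lemma minimal_sublinear_linear S p : linear_subspace S -> sublinear_on S p ->
  (forall p', sublinear_on S p' -> (forall x, S x -> p' x <= p x) ->
     forall x, S x -> p x <= p' x) ->
  linear_on S p.
Proof.
move=> lS sp pmin; have [S0 SD SZ] := lS; have [pD _] := sp.
have addp x y : S x -> S y -> p (x + y) = p x + p y.
  move=> Sx Sy; apply/eqP; rewrite eq_le pD//=.
  have := pmin _ (directional_inf_sublinear lS sp Sy)
    (fun x Sx => directional_inf_le_id lS sp Sx Sy) _ Sx.
  have := directional_inf_le lS sp Sx Sy (@ler01 R); rewrite scale1r mul1r; lra.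
split=> // a x Sx.
have [a0|a0] := leP 0 a; first exact: (sublinear_onZ lS sp).
have := addp (a *: x) ((- a) *: x) (SZ _ _ Sx) (SZ _ _ Sx).
rewrite -scalerDl subrr scale0r (sublinear_on0 lS sp).
have na : 0 <= - a by rewrite oppr_ge0 ltW.
rewrite (sublinear_onZ lS sp na)//; lra.
Qed.

(** Subadditivity of the infimum uses the chain property: of two members, the smaller one serves for
    both arguments. The infima are finite since [p x >= - p (- x) >= - q (- x)]. *)
Lemma chain_inf_sublinear S (A : set (V -> R)) q : linear_subspace S -> A !=set0 ->
  (forall p, A p -> sublinear_on S p /\ forall x, S x -> p x <= q x) ->
  (forall p p', A p -> A p' ->
     (forall x, S x -> p x <= p' x) \/ (forall x, S x -> p' x <= p x)) ->
  let h := fun x => inf [set p x | p in A] in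
  sublinear_on S h /\ forall p x, A p -> S x -> h x <= p x.
Proof.
move=> lS A0 Aq Atot h; have [S0 SD SZ] := lS.
have hle p x : A p -> S x -> h x <= p x.
  move=> Ap Sx; apply: ge_inf; last by exists p.
  have SNx : S (- x) by rewrite -scaleN1r; exact: SZ.
  exists (- q (- x)) => _ [p' Ap' <-]; have [sp' p'q] := Aq _ Ap'.
  by rewrite (le_trans _ (sublinear_onN lS sp' Sx))// lerN2 p'q.
have leh x c : (forall p, A p -> c <= p x) -> c <= h x.
  move=> hc; apply: lb_le_inf; first by case: A0 => p Ap; exists (p x), p.
  by move=> _ [p Ap <-]; exact: hc.
split=> //; split=> [x y Sx Sy|a x a0 Sx].
  rewrite -lerBlDr; apply: (leh x) => p Ap; rewrite lerBlDr -lerBlDl.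
  apply: (leh y) => p' Ap'; rewrite lerBlDl.
  have [le|le] := Atot _ _ Ap Ap'.
    rewrite (le_trans (hle _ _ Ap (SD _ _ Sx Sy)))//.
    by have [[pD _] _] := Aq _ Ap; rewrite (le_trans (pD _ _ Sx Sy))// lerD2l le.
  rewrite (le_trans (hle _ _ Ap' (SD _ _ Sx Sy)))//.
  by have [[pD _] _] := Aq _ Ap'; rewrite (le_trans (pD _ _ Sx Sy))// lerD2r le.
move: a0; rewrite le_eqVlt => /orP[/eqP<-|a0].
  rewrite scale0r mul0r; case: A0 => p Ap; rewrite (le_trans (hle _ _ Ap S0))//.
  by have [sp _] := Aq _ Ap; rewrite (sublinear_on0 lS sp).
rewrite -ler_pdivrMl//; apply: leh => p Ap; rewrite ler_pdivrMl//.
rewrite (le_trans (hle _ _ Ap (SZ _ _ Sx)))//.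
by have [sp _] := Aq _ Ap; rewrite (sublinear_onZ lS sp (ltW a0)).
Qed.

(** Zorn's lemma for the reversed pointwise order: a maximal element is a minimal sublinear
    functional below [q], hence linear. *)
Lemma linear_minorant S q : linear_subspace S -> sublinear_on S q ->
  exists2 L, linear_on S L & forall x, S x -> L x <= q x.
Proof.
move=> lS sq.
pose X := {p : V -> R | sublinear_on S p /\ forall x, S x -> p x <= q x}.
pose le (p p' : X) := `[< forall x, S x -> sval p' x <= sval p x >].
pose q0 : X := exist _ q (conj sq (fun x _ => lexx _)).
have [||A Atot|[p [sp pq]] pmax] := @ZL_preorder X q0 le.
- by move=> p; apply/asboolP => x _; exact: lexx.
- move=> p2 p1 p3 /asboolP h1 /asboolP h2; apply/asboolP => x Sx.
  exact: le_trans (h2 _ Sx) (h1 _ Sx).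
- have [A0|/set0P A0] := eqVneq A set0; first by exists q0 => p; rewrite A0.
  have [||p p'|sh hle] := @chain_inf_sublinear S (sval @` A) q lS.
  + by case: A0 => p Ap; exists (sval p), p.
  + by move=> _ [p _ <-]; exact: (svalP p).
  + move=> [r Ar <-] [r' Ar' <-].
    by have [/asboolP ?|/asboolP ?] := Atot _ _ Ar Ar'; [right|left].
  have hq : forall x, S x -> inf [set p x | p in sval @` A] <= q x.
    move=> x Sx; case: A0 => p Ap.
    have Ap' : (sval @` A) (sval p) by exists p.
    by rewrite (le_trans (hle _ _ Ap' Sx))//; exact: (svalP p).2.
  pose h0 : X := exist (fun p : V -> R => sublinear_on S p /\ forall x, S x -> p x <= q x) _ (conj sh hq).
  exists h0 => p Ap; apply/asboolP => x Sx /=.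
  by apply: hle => //; exists p.
exists p => //; apply: minimal_sublinear_linear => // p' sp' p'p.
have p'q x : S x -> p' x <= q x by move=> Sx; rewrite (le_trans (p'p _ Sx))// pq.
pose r0 : X := exist (fun p : V -> R => sublinear_on S p /\ forall x, S x -> p x <= q x) p' (conj sp' p'q).
by have /asboolP := pmax r0 (introT (asboolP _) p'p).
Qed.

(** A linear minorant of [directional_inf q v] lies below [q], and its value at [- v] is at most
    [q (- v + v) - q v = - q v], which forces equality at [v]. *)
Theorem Hahn_Banach_sublinear S q v : linear_subspace S -> sublinear_on S q -> S v ->
  exists L, [/\ linear_on S L, (forall x, S x -> L x <= q x) & L v = q v].
Proof.
move=> lS sq Sv; have [S0 SD SZ] := lS.
have [L linL Lle] := linear_minorant lS (directional_inf_sublinear lS sq Sv).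
have Lq x : S x -> L x <= q x.
  by move=> Sx; rewrite (le_trans (Lle _ Sx))// (directional_inf_le_id lS sq).
exists L; split=> //; apply/eqP; rewrite eq_le Lq//=.
have SNv : S (- v) by rewrite -scaleN1r; exact: SZ.
have := Lle _ SNv; have := directional_inf_le lS sq SNv Sv (@ler01 R).
rewrite scale1r mul1r addNr (sublinear_on0 lS sq) -[- v]scaleN1r linL.2//; lra.
Qed.

End HahnBanach.

(** * Continuous real functions *)

Section ContinuousRealFunctions.
Context {R : realType} {K : topologicalType}.
Implicit Types f g : K -> R.

Lemma ctsC (c : R) : continuous (fun _ : K => c).
Proof. by move=> x; exact: cvg_cst. Qed.

Lemma ctsD f g : continuous f -> continuous g -> continuous (fun x => f x + g x).
Proof. by move=> cf cg x; exact: (continuousD (cf x) (cg x)). Qed.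

Lemma ctsN f : continuous f -> continuous (fun x => - f x).
Proof. by move=> cf x; exact: (continuousN (cf x)). Qed.

Lemma ctsB f g : continuous f -> continuous g -> continuous (fun x => f x - g x).
Proof. by move=> cf cg x; exact: (continuousB (cf x) (cg x)). Qed.

Lemma ctsM f g : continuous f -> continuous g -> continuous (fun x => f x * g x).
Proof. by move=> cf cg x; exact: (continuousM (cf x) (cg x)). Qed.

Lemma ctsV f : continuous f -> (forall x, f x != 0) -> continuous (fun x => (f x)^-1).
Proof. by move=> cf f0 x; exact: (cvgV (f0 x) (cf x)). Qed.

Lemma cts_max f g : continuous f -> continuous g ->
  continuous (fun x => Num.max (f x) (g x)).
Proof. by move=> cf cg x; exact: (continuous_max (cf x) (cg x)). Qed.

Lemma cts_min f g : continuous f -> continuous g ->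
  continuous (fun x => Num.min (f x) (g x)).
Proof. by move=> cf cg x; exact: (continuous_min (cf x) (cg x)). Qed.

Lemma cts_open_gt f c : continuous f -> open [set x | c < f x].
Proof.
by move=> cf; apply: (@open_comp _ _ f [set y | y > c]) => //; exact: open_gt.
Qed.

Lemma cts_open_lt f c : continuous f -> open [set x | f x < c].
Proof.
by move=> cf; apply: (@open_comp _ _ f [set y | y < c]) => //; exact: open_lt.
Qed.

Lemma cts_closed_ge f c : continuous f -> closed [set x | c <= f x].
Proof.
by move=> cf; apply: (@preimage_closed _ _ f [set y | c <= y]) => //; exact: closed_ge.
Qed.

Lemma cts_closed_eq f c : continuous f -> closed [set x | f x = c].
Proof.
by move=> cf; apply: (@preimage_closed _ _ f [set c]) => //; exact: closed_eq.
Qed.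

Lemma cts_bounded f : compact [set: K] -> continuous f ->
  exists2 C, 0 <= C & forall x, `|f x| <= C.
Proof.
move=> cK cf.
have /compact_bounded[M [_ hM]] : compact (f @` [set: K]).
  by apply: continuous_compact => //; exact: continuous_subspaceT.
exists (`|M| + 1); first by rewrite addr_ge0.
by move=> x; apply: hM; [rewrite ltr_pwDr// ler_norm|exists x].
Qed.

End ContinuousRealFunctions.

(** * Bounded Borel functions and their real-valued integrals *)

Section BoundedBorel.
Context {R : realType} {K : ptopologicalType}.
Implicit Types f g : K -> R.

Definition bborel f :=
  measurable_fun [set: borel K] (f : borel K -> R) /\ exists C, forall x, `|f x| <= C.

Lemma open_borel (A : set K) : open A -> measurable (A : set (borel K)).
Proof. by move=> oA; exact: sub_sigma_algebra. Qed.

Lemma closed_borel (A : set K) : closed A -> measurable (A : set (borel K)).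
Proof.
move=> cA; rewrite -[A]setCK; apply: measurableC; apply: open_borel.
exact: closed_openC.
Qed.

Lemma cts_borel f : continuous f -> measurable_fun [set: borel K] (f : borel K -> R).
Proof.
move=> cf; apply: (measurability _ (RGenOpens.measurableE R)).
move=> _ [_ [a [b ->] <-]]; rewrite setTI; apply: open_borel.
by move/continuousP : cf; apply; exact: interval_open.
Qed.

Lemma bborel_cts f : compact [set: K] -> continuous f -> bborel f.
Proof.
move=> cK cf; split; first exact: cts_borel.
by have [C _ hC] := cts_bounded cK cf; exists C.
Qed.

Lemma bborelC c : bborel (fun=> c).
Proof. by split; [exact: measurable_cst|exists `|c|]. Qed.

Lemma bborelD f g : bborel f -> bborel g -> bborel (fun x => f x + g x).
Proof.
move=> [mf [C hC]] [mg [C' hC']]; split; first exact: measurable_funD.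
by exists (C + C') => x; rewrite (le_trans (ler_normD _ _))// lerD.
Qed.

Lemma bborelN f : bborel f -> bborel (fun x => - f x).
Proof.
move=> [mf [C hC]]; split; first exact: measurable_funN.
by exists C => x; rewrite normrN.
Qed.

Lemma bborelB f g : bborel f -> bborel g -> bborel (fun x => f x - g x).
Proof. by move=> bf bg; apply: bborelD => //; exact: bborelN. Qed.

Lemma bborelM f g : bborel f -> bborel g -> bborel (fun x => f x * g x).
Proof.
move=> [mf [C hC]] [mg [C' hC']]; split; first exact: measurable_funM.
by exists (C * C') => x; rewrite normrM ler_pM.
Qed.

Lemma bborel_min f g : bborel f -> bborel g -> bborel (fun x => Num.min (f x) (g x)).
Proof.
move=> [mf [C hC]] [mg [C' hC']]; split; first exact: measurable_minr.
exists (Num.max C C') => x; case: (leP (f x) (g x)) => _.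
  by rewrite le_max hC.
by rewrite le_max hC' orbT.
Qed.

Lemma bborel_indic (A : set (borel K)) : measurable A -> bborel (\1_A : K -> R).
Proof.
move=> mA; split; first exact: measurable_indic.
by exists 1 => x; rewrite indicE; case: (_ \in _); rewrite ?normr1 ?normr0.
Qed.

Lemma bborel_lim (h : nat -> K -> R) f C : (forall n, bborel (h n)) ->
  (forall n x, `|h n x| <= C) -> (forall x, h ^~ x @ \oo --> f x) -> bborel f.
Proof.
move=> bh hC hf; split.
  by apply: (@measurable_fun_cvg _ (borel K) R setT h) => [n|x _]; [exact: (bh n).1|exact: hf].
exists C => x.
have hn : (fun n => `|h n x|) @ \oo --> `|f x| by apply: cvg_norm; exact: hf.
rewrite -(cvg_lim _ hn)//; apply: limr_le; first by apply/cvg_ex; exists `|f x|.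
by apply: nearW => n; exact: hC.
Qed.

Variable mu : {measure set (borel K) -> \bar R}.
Hypothesis mufin : (mu setT < +oo)%E.

Definition intR f : R := Rintegral mu setT (f : borel K -> R).

Lemma bborel_integrable f : bborel f -> mu.-integrable setT (EFin \o (f : borel K -> R)).
Proof.
move=> [mf [C hC]]; apply: measurable_bounded_integrable => //.
exists C; split; first exact: num_real.
by move=> M CM x _ /=; rewrite (le_trans (hC x))// ltW.
Qed.

Lemma integE f : bborel f -> integ mu f = (intR f)%:E.
Proof. by move=> bf; rewrite /integ /intR /Rintegral fineK//; apply: integrable_fin_num => //; exact: bborel_integrable. Qed.

Lemma intRD f g : bborel f -> bborel g -> intR (fun x => f x + g x) = intR f + intR g.
Proof. by move=> bf bg; rewrite /intR RintegralD//; exact: bborel_integrable. Qed.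

Lemma intRB f g : bborel f -> bborel g -> intR (fun x => f x - g x) = intR f - intR g.
Proof. by move=> bf bg; rewrite /intR RintegralB//; exact: bborel_integrable. Qed.

Lemma intRZ c f : bborel f -> intR (fun x => c * f x) = c * intR f.
Proof. by move=> bf; rewrite /intR RintegralZl//; exact: bborel_integrable. Qed.

Lemma intRC c : intR (fun=> c) = c * fine (mu setT).
Proof. by rewrite /intR Rintegral_cst. Qed.

Lemma intR_le f g : bborel f -> bborel g -> (forall x, f x <= g x) -> intR f <= intR g.
Proof. by move=> bf bg fg; apply: le_Rintegral => //; exact: bborel_integrable. Qed.

Lemma intR_ge0 f : (forall x, 0 <= f x) -> 0 <= intR f.
Proof. by move=> f0; exact: Rintegral_ge0. Qed.

Lemma intR_norm_le f C : bborel f -> (forall x, `|f x| <= C) ->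
  `|intR f| <= C * fine (mu setT).
Proof.
move=> bf hC; rewrite ler_norml -mulNr -!intRC.
by apply/andP; split; apply: intR_le => //; try exact: bborelC;
  move=> x; have := hC x; rewrite ler_norml => /andP[].
Qed.

Lemma intR_indic (A : set (borel K)) : measurable A ->
  intR (\1_A : K -> R) = fine (mu A).
Proof. by move=> mA; rewrite /intR /Rintegral integral_indic// setIT. Qed.

(** With C and C' bounding |f| and |g|, adding (C + C') times the indicator of N to g leaves its
    integral unchanged and makes the inequality hold everywhere. *)
Lemma intR_le_ae f g (N : set (borel K)) : bborel f -> bborel g ->
  measurable N -> mu N = 0%E -> (forall x, ~ N x -> f x <= g x) -> intR f <= intR g.
Proof.
move=> bf bg mN N0 fg; have [_ [C hC]] := bf; have [_ [C' hC']] := bg.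
have bN := bborel_indic mN.
have bCN : bborel (fun x => (C + C') * (\1_N x : R)) by apply: bborelM => //; exact: bborelC.
have -> : intR g = intR (fun x => g x + (C + C') * (\1_N x : R)).
  by rewrite intRD// intRZ// intR_indic// N0 mulr0 addr0.
apply: intR_le => //; first exact: bborelD.
move=> x; rewrite indicE; have [xN|xN] := pselect (N x).
  rewrite mem_set// mulr1.
  have := hC x; have := hC' x; rewrite !ler_norml => /andP[? ?] /andP[? ?]; lra.
by rewrite memNset// mulr0 addr0 fg.
Qed.

Lemma intR_eq_ae f g (N : set (borel K)) : bborel f -> bborel g ->
  measurable N -> mu N = 0%E -> (forall x, ~ N x -> f x = g x) -> intR f = intR g.
Proof.
move=> bf bg mN N0 fg; apply/eqP; rewrite eq_le.
by rewrite !(intR_le_ae _ _ mN)// => x /fg ->.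
Qed.

Lemma intR_bounded_cvg (h : nat -> K -> R) f C : (forall n, bborel (h n)) ->
  (forall n x, `|h n x| <= C) -> (forall x, h ^~ x @ \oo --> f x) ->
  (fun n => intR (h n)) @ \oo --> intR f.
Proof.
move=> bh hC hf; have bf := bborel_lim bh hC hf.
have [] := @dominated_convergence _ (borel K) R mu setT measurableT
  (fun n => EFin \o (h n : borel K -> R)) (EFin \o (f : borel K -> R)) (EFin \o (cst C : borel K -> R)).
- by move=> n; apply/measurable_EFinP; exact: (bh n).1.
- by apply/measurable_EFinP; exact: bf.1.
- by apply: aeW => x _; apply: cvg_EFin => /=; [exact: nearW|exact: hf].
- exact: (bborel_integrable (bborelC C)).
- by apply: aeW => x n _; rewrite /= lee_fin.
move=> _ _; rewrite /intR /Rintegral.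
have fin g : bborel g -> (\int[mu]_(x in setT) (EFin \o (g : borel K -> R)) x)%E = (fine (\int[mu]_(x in setT) (g x)%:E)%E)%:E.
  by move=> bg; rewrite fineK//; apply: integrable_fin_num => //; exact: bborel_integrable.
rewrite (fin _ bf); under eq_fun do rewrite (fin _ (bh _)).
by move/fine_cvg.
Qed.

Lemma intR_eq0_null f : bborel f -> (forall x, 0 <= f x) -> intR f <= 0 ->
  measurable ([set x | f x != 0] : set (borel K)) /\ mu [set x | f x != 0] = 0%E.
Proof.
move=> bf f0 If.
have E : intR f = 0 by apply/eqP; rewrite eq_le If intR_ge0.
have mN : measurable ([set x | f x != 0] : set (borel K)).
  have -> : [set x | f x != 0] = setT `&` (f : borel K -> R) @^-1` (~` [set 0]).
    by rewrite setTI; apply/seteqP; split=> x /= /eqP.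
  by apply: bf.1 => //; apply: measurableC.
split=> //.
have := integE bf; rewrite E /integ => I0.
have mf : measurable_fun setT (EFin \o (f : borel K -> R)).
  by apply/measurable_EFinP; exact: bf.1.
have [h _] := @ae_eq_integral_abs _ (borel K) R mu setT measurableT _ mf.
have [|A [mA A0 sA]] := h _.
  by apply: etrans I0; apply: eq_integral => x _ /=; rewrite ger0_norm.
apply/eqP; rewrite eq_le measure_ge0 andbT -A0.
apply: le_measure; rewrite ?inE// => x /= fx; apply: sA => /= /(_ Logic.I)[].
exact/eqP.
Qed.

End BoundedBorel.

(** * Riesz representation of positive functionals on C(K) *)

Section Riesz.
Context {R : realType} {K : ptopologicalType}.
Hypotheses (hK : hausdorff_space K) (cK : compact [set: K]).
Variable L : (K -> R) -> R.
Hypothesis L_lin : linear_on [set f : K -> R | continuous f] L.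
Hypothesis L_pos : forall f : K -> R, continuous f -> (forall x, 0 <= f x) -> 0 <= L f.
Implicit Types (f g : K -> R) (O A : set K).

Let LD f g : continuous f -> continuous g -> L (fun x => f x + g x) = L f + L g.
Proof. by move=> cf cg; exact: L_lin.1. Qed.

Let LZ c f : continuous f -> L (fun x => c * f x) = c * L f.
Proof. by move=> cf; exact: (L_lin.2 c f). Qed.

Let LB f g : continuous f -> continuous g -> L (fun x => f x - g x) = L f - L g.
Proof.
move=> cf cg; have -> : (fun x => f x - g x) = (fun x => f x + (-1) * g x).
  by apply/funext => x; rewrite mulN1r.
by rewrite LD//; [rewrite LZ// mulN1r|apply: ctsM => //; exact: ctsC].
Qed.

Let L_le f g : continuous f -> continuous g -> (forall x, f x <= g x) -> L f <= L g.
Proof.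
move=> cf cg fg; rewrite -subr_ge0 -LB//; apply: L_pos; first exact: ctsB.
by move=> x; rewrite subr_ge0.
Qed.

Let L1 := L (fun=> 1).

Let L_cst c : L (fun=> c) = c * L1.
Proof.
rewrite -LZ; last exact: ctsC.
by congr L; apply/funext => x; rewrite mulr1.
Qed.

Let L1_ge0 : 0 <= L1.
Proof. by apply: L_pos => //; exact: ctsC. Qed.

Let le_eps (a c : R) : (forall e, 0 < e -> a <= c + e * L1) -> a <= c.
Proof.
move=> h; apply/ler_addgt0Pr => e e0.
have L1p : 0 < L1 + 1 by rewrite ltr_wpDl.
have := h (e / (L1 + 1)) (divr_gt0 e0 L1p); move/le_trans; apply.
by rewrite lerD2l mulrAC ler_pdivrMr// ler_pM2l// lerDl.
Qed.

(** Vanishing off [O] replaces the usual condition on the support. Compactness is recovered from the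
    sets {e <= f}, at the price of an error [e * L1]. *)
Definition test_functions O : set (K -> R) :=
  [set f : K -> R | [/\ continuous f, forall x, 0 <= f x <= 1 & forall x, ~ O x -> f x = 0]].

Definition open_content O : R := sup [set L f | f in test_functions O].

Let test_le1 O f : test_functions O f -> L f <= L1.
Proof. by move=> [cf f01 _]; apply: L_le => // [|x]; [exact: ctsC|have /andP[] := f01 x]. Qed.

Let test0 O : test_functions O (fun=> 0).
Proof. by split=> // [|x]; [exact: ctsC|rewrite lexx ler01]. Qed.

Let le_content O f : test_functions O f -> L f <= open_content O.
Proof.
move=> tf; apply: ub_le_sup; last by exists f.
by exists L1 => _ [g tg <-]; exact: test_le1 tg.
Qed.

Let content_le O c : (forall f, test_functions O f -> L f <= c) -> open_content O <= c.
Proof.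
move=> h; apply: ge_sup; first by exists (L (fun=> 0)), (fun=> 0).
by move=> _ [g tg <-]; exact: h.
Qed.

Let content_ge0 O : 0 <= open_content O.
Proof. by rewrite (le_trans _ (le_content (test0 O)))// L_cst mul0r. Qed.

Let content_leL1 O : open_content O <= L1.
Proof. by apply: content_le => f; exact: test_le1. Qed.

Let content_mono O O' : O `<=` O' -> open_content O <= open_content O'.
Proof.
move=> OO'; apply: content_le => f [cf f01 f0]; apply: le_content; split=> // x nx.
by apply: f0 => /OO'.
Qed.

Let content_setT : open_content setT = L1.
Proof.
apply/eqP; rewrite eq_le content_leL1/=; apply: le_content; split=> //.
- exact: ctsC.
- by move=> x; rewrite ler01 lexx.
- by move=> x /(_ Logic.I).
Qed.

Let content0 : open_content set0 = 0.
Proof.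
apply/eqP; rewrite eq_le content_ge0 andbT; apply: content_le => f [cf _ f0].
rewrite [f](_ : _ = fun=> 0); first by rewrite L_cst mul0r.
by apply/funext => x; rewrite f0.
Qed.

Let cts_excess f e : continuous f -> continuous (fun x => Num.max (f x - e) 0).
Proof. by move=> cf; apply: cts_max; [apply: ctsB => //|]; exact: ctsC. Qed.

(** Let g be a Urysohn function, 0 off [O2] and 1 on the part of {e <= f} off [O1]. Then f <= max(f
    - e, 0) (1 - g) + f g + e, where the first term vanishes off [O1] and the second off [O2]. *)
Let contentU O1 O2 : open O1 -> open O2 ->
  open_content (O1 `|` O2) <= open_content O1 + open_content O2.
Proof.
move=> o1 o2; apply: content_le => f [cf f01 f0]; apply: le_eps => e e0.
have sep : uniform_separator (~` O2) ([set x | e <= f x] `&` ~` O1).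
  apply: (proj1 (@normal_separatorP R K) (compact_normal hK cK)).
  - exact: open_closedC.
  - by apply: closedI; [exact: cts_closed_ge|exact: open_closedC].
  - apply/seteqP; split=> // x [n2 [/= ef n1]].
    by move: ef; rewrite f0 ?leNgt ?e0// => -[].
pose g := @Urysohn K R (~` O2) ([set x | e <= f x] `&` ~` O1).
have cg : continuous g by exact: Urysohn_continuous.
have g01 x : 0 <= g x <= 1.
  have /= := @Urysohn_range K R (~` O2) ([set x | e <= f x] `&` ~` O1) (g x).
  by rewrite in_itv/=; apply; exists x.
have g0 x : ~ O2 x -> g x = 0.
  by move=> nx; apply: (Urysohn_sub0 sep); exists x.
have g1 x : e <= f x -> ~ O1 x -> g x = 1.
  by move=> ef nx; apply: (Urysohn_sub1 sep); exists x.
pose f1 x := Num.max (f x - e) 0 * (1 - g x).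
pose f2 x := f x * g x.
have cf1 : continuous f1 by apply: ctsM; [exact: cts_excess|apply: ctsB => //; exact: ctsC].
have cf2 : continuous f2 by exact: ctsM.
have t1 : test_functions O1 f1.
  split=> // [x|x nx].
    have /andP[g0x g1x] := g01 x; have /andP[f0x f1x] := f01 x.
    rewrite /f1; case: (leP (f x - e) 0) => h; first by rewrite mul0r lexx ler01.
    by rewrite mulr_ge0 ?mulr_ile1//; lra.
  rewrite /f1; have [ef|ef] := leP e (f x); first by rewrite g1// subrr mulr0.
  by rewrite max_r ?mul0r//; lra.
have t2 : test_functions O2 f2.
  split=> // [x|x nx]; last by rewrite /f2 g0// mulr0.
  have /andP[g0x g1x] := g01 x; have /andP[f0x f1x] := f01 x.
  by rewrite mulr_ge0 ?mulr_ile1.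
have /le_trans-> // : L f <= L f1 + L f2 + e * L1.
  rewrite -LD// -L_cst -LD//; [|exact: ctsD|exact: ctsC].
  apply: L_le => //; first by apply: ctsD; [exact: ctsD|exact: ctsC].
  move=> x; rewrite /f1 /f2.
  have /andP[g0x g1x] := g01 x; have /andP[f0x f1x] := f01 x.
  by case: (leP (f x - e) 0) => h; nra.
by rewrite lerD2r lerD// le_content.
Qed.

Let content_bigsetU (O : nat -> set K) N : (forall i, open (O i)) ->
  open_content (\big[setU/set0]_(i < N) O i) <= \sum_(i < N) open_content (O i).
Proof.
move=> oO; elim: N => [|N IH]; first by rewrite !big_ord0 content0.
rewrite !big_ord_recr/= (le_trans (contentU _ _))//; last by rewrite lerD2r.
by apply: big_ind => //; [exact: open0|exact: openU].
Qed.

(** Finitely many [O i] cover the compact set {e <= f}, and max(f - e, 0) is a test function on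
    their union. *)
Let content_bigcup (O : nat -> set K) f e : (forall i, open (O i)) -> 0 < e ->
  test_functions (\bigcup_i O i) f ->
  exists N, L f <= \sum_(i < N) open_content (O i) + e * L1.
Proof.
move=> oO e0 [cf f01 f0].
have cF : compact [set x | e <= f x].
  by apply: subclosed_compact cK _ => //; exact: cts_closed_ge.
move: cF; rewrite compact_cover => /(_ nat setT O (fun i _ => oO i)).
case=> [x /= ef|D _ FD].
  have [[i _ Oi]|nO] := pselect ((\bigcup_i O i) x); first by exists i.
  by move: ef; rewrite f0// leNgt e0.
exists (\max_(i <- finmap.enum_fset D) i)%N.+1.
apply: le_trans (_ : L (fun x => Num.max (f x - e) 0) + e * L1 <= _).
  rewrite -L_cst -LD; [|exact: cts_excess|exact: ctsC].
  apply: L_le => //; first by apply: ctsD; [exact: cts_excess|exact: ctsC].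
  by move=> x; case: (leP (f x - e) 0); lra.
rewrite lerD2r; apply: le_trans (content_bigsetU _ oO).
apply: le_content; split; first exact: cts_excess.
- by move=> x; have /andP[? ?] := f01 x; case: (leP (f x - e) 0) => ?; rewrite ?lexx ?ler01//; lra.
- move=> x nx; case: (leP (f x - e) 0) => // h; exfalso; apply: nx.
  have /FD[i Di Oi] : [set x | e <= f x] x by rewrite /=; lra.
  rewrite -bigcup_mkord; exists i => //=; rewrite ltnS.
  exact: leq_bigmax_seq.
Qed.

Definition riesz_outer A : \bar R :=
  (inf [set open_content O | O in [set O | open O /\ A `<=` O]])%:E.

Let outer_le O A : open O -> A `<=` O -> (riesz_outer A <= (open_content O)%:E)%E.
Proof.
move=> oO AO; rewrite lee_fin; apply: ge_inf; last by exists O.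
by exists 0; move=> _ [ O' _ <-]; exact: content_ge0.
Qed.

Let le_outer A c : (forall O, open O -> A `<=` O -> c <= open_content O) ->
  (c%:E <= riesz_outer A)%E.
Proof.
move=> h; rewrite lee_fin; apply: lb_le_inf.
  by exists (open_content setT), setT => //; split=> //; exact: openT.
by move=> _ [ O [ oO AO] <-]; exact: h.
Qed.

Let outer_open O : open O -> riesz_outer O = (open_content O)%:E.
Proof.
move=> oO; apply/eqP; rewrite eq_le outer_le//=; apply: le_outer => O' _.
exact: content_mono.
Qed.

Let outer_ge0 A : (0 <= riesz_outer A)%E.
Proof. exact: le_outer. Qed.

Let outer0 : riesz_outer set0 = 0%E.
Proof. by rewrite outer_open ?content0//; exact: open0. Qed.

Let outer_mono : {homo riesz_outer : A B / A `<=` B >-> (A <= B)%E}.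
Proof.
move=> A B AB; apply: le_outer => O oO BO.
by have := outer_le oO (subset_trans AB BO); rewrite lee_fin.
Qed.

Let outer_approx A e : 0 < e ->
  exists O, [/\ open O, A `<=` O & ((open_content O)%:E <= riesz_outer A + e%:E)%E].
Proof.
move=> e0.
have [|_ [ O [ oO AO] <-] h] := @inf_adherent R [set open_content O | O in [set O | open O /\ A `<=` O]] e e0.
  split; first by exists (open_content setT), setT => //; split=> //; exact: openT.
  by exists 0; move=> _ [ O _ <-]; exact: content_ge0.
by exists O; split=> //; rewrite lee_fin ltW.
Qed.

Let outer_sigma_subadditive : sigma_subadditive riesz_outer.
Proof.
move=> F; apply/lee_addgt0Pr => e e0.
have e2 n : 0 < e / (2 ^ n.+1)%:R by rewrite divr_gt0// ltr0n expn_gt0.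
have /choice[ O hO] := fun n => outer_approx (F n) (e2 n).
have oO n : open (O n) by have [] := hO n.
rewrite (le_trans _ (epsilon_trick xpredT (fun n => outer_ge0 (F n)) (ltW e0)))//.
have oU : open (\bigcup_n O n) by exact: bigcup_open.
have FU : \bigcup_n F n `<=` \bigcup_n O n.
  by move=> x [n _ Fx]; exists n => //; have [_ + _] := hO n; exact.
apply: (le_trans (outer_le oU FU)).
apply: (@le_trans _ _ (\sum_(i <oo) (open_content (O i))%:E)%E); last first.
  by apply: lee_nneseries => [n _|n _]; [rewrite lee_fin|have [] := hO n].
have [->|sfin] := eqVneq (\sum_(i <oo) (open_content (O i))%:E)%E +oo%E.
  by rewrite leey.
have s0 : (0 <= \sum_(i <oo) (open_content (O i))%:E)%E.
  by apply: nneseries_ge0 => n _; rewrite lee_fin.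
have sfin' : (\sum_(i <oo) (open_content (O i))%:E)%E \is a fin_num.
  by rewrite ge0_fin_numE// ltey.
rewrite -(fineK sfin') lee_fin; apply: content_le => f tf; apply: le_eps => d d0.
have [N /le_trans->//] := content_bigcup oO d0 tf.
rewrite lerD2r -lee_fin fineK// -sumEFin -(big_mkord xpredT (fun i => (open_content (O i))%:E)).
by apply: nneseries_lim_ge => n _; rewrite lee_fin.
Qed.

Let outer : {outer_measure set K -> \bar R} :=
  HB.pack riesz_outer (isOuterMeasure.Build R K riesz_outer outer0 outer_ge0 outer_mono outer_sigma_subadditive).

(* For V open containing X, add to a test function f on V `&` O a test function
   on V minus the closed set where f is at least e: the sum, after lowering f by e,
   is again a test function on V. *)
Let open_caratheodory O : open O -> caratheodory_measurable riesz_outer O.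
Proof.
move=> oO; apply: (@le_caratheodory_measurable R K outer) => X; rewrite /=.
rewrite /riesz_outer -EFinD; apply: le_outer => V oV XV.
rewrite -lerBrDr.
apply: (@le_trans _ _ (open_content (V `&` O))).
  by rewrite -lee_fin; apply: outer_le; [exact: openI|exact: setSI].
apply: content_le => f [cf f01 f0]; rewrite lerBrDr addrC -lerBrDr.
apply: le_eps => e e0.
have oW : open (V `&` [set x | f x < e]) by apply: openI => //; exact: cts_open_lt.
apply: (@le_trans _ _ (open_content (V `&` [set x | f x < e]))).
  rewrite -lee_fin; apply: outer_le => // x [Xx nO]; split; first exact: XV.
  by rewrite /= f0// => -[].
apply: content_le => g [cg g01 g0].
rewrite addrAC lerBrDr.
have ch : continuous (fun x => Num.max (f x - e) 0) by exact: cts_excess.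
apply: (@le_trans _ _ (L g + (L (fun x => Num.max (f x - e) 0) + e * L1))).
  rewrite lerD2l -L_cst -LD//; last exact: ctsC.
  apply: L_le => //; first by apply: ctsD => //; exact: ctsC.
  by move=> x; case: (leP (f x - e) 0); lra.
rewrite addrA lerD2r -LD//; apply: le_content; split; first exact: ctsD.
- move=> x; have /andP[? ?] := f01 x; have /andP[? ?] := g01 x.
  case: (leP (f x - e) 0) => h; first by lra.
  by rewrite g0; [lra|move=> [_ /=]; lra].
- move=> x nV; rewrite g0; last by move=> [].
  by rewrite f0; [rewrite max_r; lra|move=> []].
Qed.

Let borel_caratheodory (A : set (borel K)) : measurable A ->
  caratheodory_measurable riesz_outer A.
Proof.
have : <<s @open K >> `<=` caratheodory_measurable riesz_outer.
  apply: smallest_sub; last by move=> O oO; exact: open_caratheodory.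
  split.
  - exact: (caratheodory_measurable_set0 outer).
  - by move=> B mB; rewrite setTD; exact: (@caratheodory_measurable_setC _ _ outer).
  - by move=> F mF; exact: (@caratheodory_measurable_bigcup _ _ outer).
exact.
Qed.

Let riesz_measure0 : (riesz_outer : set (borel K) -> \bar R) set0 = 0%E.
Proof. exact: outer0. Qed.

Let riesz_sigma_additive : semi_sigma_additive (riesz_outer : set (borel K) -> \bar R).
Proof.
move=> F mF tF mUF.
apply: (@caratheodory_measure_sigma_additive R K outer) => //.
- by move=> n; exact: borel_caratheodory.
- exact: borel_caratheodory.
Qed.

Let riesz_measure : {measure set (borel K) -> \bar R} :=
  HB.pack (riesz_outer : set (borel K) -> \bar R)
    (isMeasure.Build _ (borel K) R riesz_outer riesz_measure0 outer_ge0 riesz_sigma_additive).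

Let riesz_fin : (riesz_measure setT < +oo)%E.
Proof. by rewrite /= /riesz_outer ltry. Qed.

Let riesz_setT : fine (riesz_measure setT) = L1.
Proof.
by rewrite -content_setT; exact: (congr1 fine (outer_open openT)).
Qed.

(** Outer regularity holds by construction. Inner regularity at [A] is outer regularity at its
    complement, since complements of open sets are compact in [K]. *)
Let riesz_radon : radon riesz_measure.
Proof.
split; first exact: riesz_fin.
move=> A mA; apply/eqP; rewrite eq_le; apply/andP; split; last first.
  apply: ge_ereal_sup => _ [C [cC CA] <-]; exact: outer_mono.
apply/lee_addgt0Pr => e e0.
have [ O [ oO AO hO]] := outer_approx (~` A) e0.
have OA : ~` O `<=` A by rewrite -[A]setCK; exact: subsetC.
have mO : measurable (O : set (borel K)) by exact: open_borel.
have cO : compact (~` O : set K).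
  by apply: subclosed_compact cK _ => //; exact: open_closedC.
apply: (@le_trans _ _ (riesz_measure (~` O) + e%:E)%E); last first.
  by rewrite leeD2r//; apply: ereal_sup_ubound; exists (~` O).
have fin B : riesz_measure B \is a fin_num by [].
have EC B : measurable B -> riesz_measure (~` B) = (riesz_measure setT - riesz_measure B)%E.
  by move=> mB; rewrite -setTD measureD// setTI.
have EA := EC _ (measurableC mA); rewrite setCK in EA.
have EO := EC _ mO.
have : (riesz_measure O <= riesz_measure (~` A) + e%:E)%E by rewrite -(outer_open oO) in hO.
rewrite EA EO -(fineK (fin setT)) -(fineK (fin O)) -(fineK (fin (~` A))) -!EFinB -!EFinD !lee_fin.
lra.
Qed.

(** The slice of f between the heights c and c + h, divided by h, is a test function on {c < f}. *)
Let layer f c h : continuous f -> 0 < h ->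
  L (fun x => Num.min (f x) (c + h) - Num.min (f x) c) <=
  h * fine (riesz_measure [set x | c < f x]).
Proof.
move=> cf h0; rewrite -ler_pdivrMl// -LZ; last first.
  by apply: ctsB; apply: cts_min => //; exact: ctsC.
have -> : fine (riesz_measure [set x | c < f x]) = open_content [set x | c < f x].
  have ogt : open [set x | c < f x] by exact: cts_open_gt.
  exact: (congr1 fine (outer_open ogt)).
apply: le_content; split.
- by apply: ctsM; [exact: ctsC|apply: ctsB; apply: cts_min => //; exact: ctsC].
- move=> x; rewrite ler_pdivlMl// mulr0 ler_pdivrMl// mulr1.
  by case: (leP (f x) (c + h)) => ?; case: (leP (f x) c) => ?; lra.
- move=> x /negP; rewrite -leNgt => fc; rewrite !min_l ?subrr ?mulr0//; lra.
Qed.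

(** Write nu for the measure and cut f into slices of height h. On the slice starting at c, [L] is
    at most h nu{c < f}, while the integral is at least h nu{c + h < f}. The shift by one slice
    telescopes, at a total cost of h nu{0 < f} <= h [L1]. *)
Let riesz_le f : continuous f -> (forall x, 0 <= f x) -> L f <= intR riesz_measure f.
Proof.
move=> cf f0; apply: le_eps => h h0.
have bb g : continuous g -> bborel g by exact: bborel_cts.
have cm c : continuous (fun x => Num.min (f x) c) by apply: cts_min => //; exact: ctsC.
have mgt c : measurable ([set x | c < f x] : set (borel K)).
  by apply: open_borel; exact: cts_open_gt.
have claim n : L (fun x => Num.min (f x) (n%:R * h)) +
    h * fine (riesz_measure [set x | n%:R * h < f x]) <=
    intR riesz_measure (fun x => Num.min (f x) (n%:R * h)) + h * L1.
  elim: n => [|n IH].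
    rewrite mul0r [X in L X](_ : _ = fun=> 0); last by apply/funext => x; rewrite min_r.
    rewrite L_cst mul0r add0r ler_wpDl ?intR_ge0// => [x|]; first by rewrite le_min f0 lexx.
    rewrite ler_pM2l// -riesz_setT fine_le//; apply: le_measure; rewrite ?inE//.
  have e1 : n.+1%:R * h = n%:R * h + h by rewrite -natr1 mulrDl mul1r.
  rewrite e1.
  have l := layer (n%:R * h) cf h0; rewrite LB// in l.
  have : h * fine (riesz_measure [set x | n%:R * h + h < f x]) <=
      intR riesz_measure (fun x => Num.min (f x) (n%:R * h + h)) - intR riesz_measure (fun x => Num.min (f x) (n%:R * h)).
    rewrite -intRB//; try exact: bb.
    rewrite -intR_indic// -intRZ//; last exact: bborel_indic.
    apply: intR_le => //.
    - by apply: bborelM; [exact: bborelC|exact: bborel_indic].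
    - by apply: bborelB; exact: bb.
    move=> x; rewrite indicE; have [fx|fx] := pselect (n%:R * h + h < f x).
      rewrite mem_set// mulr1 !min_r; lra.
    rewrite memNset// mulr0; case: (leP (f x) (n%:R * h + h)) => ?; case: (leP (f x) (n%:R * h)) => ?; lra.
  lra.
have [C C0 hC] := cts_bounded cK cf.
have [n hn] : exists n, C <= n%:R * h.
  exists (Num.truncn (C / h)).+1; rewrite -ler_pdivrMr//; exact/ltW/truncnS_gt.
have := claim n; rewrite [X in L X](_ : _ = f); last first.
  apply/funext => x; rewrite min_l// (le_trans _ hn)//.
  exact: le_trans (ler_norm _) (hC x).
rewrite [X in intR _ X](_ : _ = f); last first.
  apply/funext => x; rewrite min_l// (le_trans _ hn)//.
  exact: le_trans (ler_norm _) (hC x).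
have := mulr_ge0 (ltW h0) (fine_ge0 (measure_ge0 riesz_measure [set x | n%:R * h < f x])).
by lra.
Qed.

Theorem Riesz_representation : exists nu : {measure set (borel K) -> \bar R},
  radon nu /\ forall f, continuous f -> integ nu f = (L f)%:E.
Proof.
exists riesz_measure; split; first exact: riesz_radon.
move=> f cf; rewrite (integE riesz_fin); last exact: bborel_cts.
congr EFin; have [C C0 hC] := cts_bounded cK cf.
have cC : continuous (fun _ : K => C) by exact: ctsC.
have b1 : bborel f by exact: bborel_cts.
have b2 : bborel (fun _ : K => C) by exact: bborelC.
have fC x : - C <= f x <= C by have := hC x; rewrite ler_norml.
(* The total mass is [L1], so the inequality for the nonnegative functions C + f and C - f gives
   both directions for f. *)
have : L (fun x => C + f x) <= intR riesz_measure (fun x => C + f x).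
  by apply: riesz_le; [exact: ctsD|move=> x; have /andP[? ?] := fC x; lra].
have : L (fun x => C - f x) <= intR riesz_measure (fun x => C - f x).
  by apply: riesz_le; [exact: ctsB|move=> x; have /andP[? ?] := fC x; lra].
rewrite (LD cC cf) (LB cC cf) (intRD riesz_fin b2 b1) (intRB riesz_fin b2 b1).
by rewrite intRC riesz_setT L_cst; lra.
Qed.

End Riesz.

(** * Elementary facts on metrics *)

Section MetricFacts.
Context {R : realType} {T : Type} {d : T -> T -> R}.
Hypothesis dm : is_metric d.

Lemma metric_refl x : d x x = 0.
Proof. by have [h _ _] := dm; apply/h. Qed.

Lemma metric_sym x y : d x y = d y x.
Proof. by have [_ h _] := dm. Qed.

Lemma metric_triangle x y z : d x z <= d x y + d y z.
Proof. by have [_ _ h] := dm. Qed.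

Lemma metric_ge0 x y : 0 <= d x y.
Proof.
by have := metric_triangle x y x; rewrite metric_refl (metric_sym y x); lra.
Qed.

Lemma metric_gt0 x y : x <> y -> 0 < d x y.
Proof.
move=> xy; rewrite lt_neqAle metric_ge0 andbT eq_sym; apply/eqP => dxy.
by apply: xy; have [h _ _] := dm; apply/h.
Qed.

End MetricFacts.

(** * The cone G and the use of minimality *)

Section StoneCech.
Context {R : realType} {T : Type} {d : T -> T -> R} {K : ptopologicalType}
  {iota : T -> T -> K}.
Hypotheses (dm : is_metric d) (sc : is_stone_cech_tilde d iota).
Implicit Types f g : K -> R.

Lemma tilde_le f g : continuous f -> continuous g ->
  (forall x y, x <> y -> f (iota x y) <= g (iota x y)) -> forall z, f z <= g z.
Proof.
have [_ _ _ dense _] := sc => cf cg fg z.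
have cl : closed [set z | 0 <= g z - f z] by apply: cts_closed_ge; exact: ctsB.
rewrite -subr_ge0; apply: cl.
have : closure [set z | exists x y, x <> y /\ z = iota x y] z by rewrite dense.
by apply: closureS => _ [x [y [xy ->]]] /=; rewrite subr_ge0 fg.
Qed.

Lemma tilde_eq f g : continuous f -> continuous g ->
  (forall x y, x <> y -> f (iota x y) = g (iota x y)) -> forall z, f z = g z.
Proof.
move=> cf cg fg z; apply/eqP; rewrite eq_le.
by rewrite !tilde_le// => x y xy; rewrite fg.
Qed.

Lemma Gset_cst (c : R) : 0 <= c -> Gset d iota (fun=> c).
Proof.
move=> c0; split; first exact: ctsC.
by move=> x u y _ _ _; rewrite -mulrDl ler_wpM2r// metric_triangle.
Qed.

Lemma GsetD f g : Gset d iota f -> Gset d iota g -> Gset d iota (fun z => f z + g z).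
Proof.
move=> [cf hf] [cg hg]; split; first exact: ctsD.
by move=> x u y xu uy xy; have := hf x u y xu uy xy; have := hg x u y xu uy xy; lra.
Qed.

Lemma GsetZ (a : R) f : 0 <= a -> Gset d iota f -> Gset d iota (fun z => a * f z).
Proof.
move=> a0 [cf hf]; split; first by apply: ctsM => //; exact: ctsC.
move=> x u y xu uy xy; rewrite !(mulrCA _ a) -mulrDr ler_wpM2l//.
exact: hf.
Qed.

Variable mu : {measure set (borel K) -> \bar R}.
Hypotheses (rmu : radon mu) (mumin : preceq_minimal d iota mu).

(* The sublinear functional f |-> inf {int m g : g in G, g >= f} dominates a linear
   functional agreeing with it at - g0; adding int (1 - m) f represents it by a
   measure preceding mu, so minimality bounds its value at - g0. *)
Lemma minimal_infimum (m g0 : K -> R) : bborel m -> (forall z, 0 <= m z <= 1) ->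
  Gset d iota g0 -> forall e, 0 < e ->
  exists g, [/\ Gset d iota g, forall z, - g0 z <= g z &
    intR mu (fun z => m z * (g z + g0 z)) < e].
Proof.
move=> bm m01 Gg0 e e0; have [hK cK _ _ _] := sc.
have fin : (mu setT < +oo)%E by have [] := rmu.
have bb f : continuous f -> bborel f by exact: bborel_cts.
have bmf f : continuous f -> bborel (fun z => m z * f z) by move=> cf; apply: bborelM => //; exact: bb.
pose S := [set f : K -> R | continuous f].
pose above f := [set intR mu (fun z => m z * g z) | g in [set g | Gset d iota g /\ forall z, f z <= g z]].
pose q f := inf (above f).
have lS : linear_subspace S.
  split; first exact: ctsC.
  - by move=> f g cf cg; exact: ctsD.
  - by move=> a f cf; apply: ctsM => //; exact: ctsC.
have imono f g : continuous f -> continuous g -> (forall z, f z <= g z) ->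
    intR mu (fun z => m z * f z) <= intR mu (fun z => m z * g z).
  move=> cf cg fg; apply: (intR_le fin); [exact: bmf|exact: bmf|].
  by move=> z; rewrite ler_wpM2l//; have /andP[] := m01 z.
have q_le f g : continuous f -> Gset d iota g -> (forall z, f z <= g z) ->
    q f <= intR mu (fun z => m z * g z).
  move=> cf Gg fg; apply: ge_inf; last by exists g.
  exists (intR mu (fun z => m z * f z)) => _ [g' [[cg' _] fg'] <-]; exact: imono.
have ne f : continuous f -> above f !=set0.
  move=> cf; have [C C0 hC] := cts_bounded cK cf.
  exists (intR mu (fun z => m z * C)), (fun=> C) => //; split; first exact: Gset_cst.
  by move=> z; exact: le_trans (ler_norm _) (hC z).
have le_q f c : continuous f -> (forall g, Gset d iota g -> (forall z, f z <= g z) ->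
    c <= intR mu (fun z => m z * g z)) -> c <= q f.
  move=> cf h; apply: lb_le_inf; first exact: ne.
  by move=> _ [g [Gg fg] <-]; exact: h.
have sq : sublinear_on S q.
  split=> [f g cf cg|a f a0 cf].
    rewrite -lerBlDr; apply: (le_q _ _ cf) => f' Gf' ff'.
    rewrite lerBlDr -lerBlDl; apply: (le_q _ _ cg) => g' Gg' gg'.
    rewrite lerBlDl.
    have [[cf' _] [cg' _]] := (Gf', Gg').
    rewrite -(intRD fin (bmf _ cf') (bmf _ cg')).
    have -> : (fun z => m z * f' z + m z * g' z) = (fun z => m z * (f' z + g' z)).
      by apply/funext => z; rewrite mulrDr.
    apply: q_le; [exact: ctsD|exact: GsetD|].
    by move=> z; rewrite lerD.
  have cZ : continuous (a *: f : K -> R) by apply: ctsM => //; exact: ctsC.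
  have qa g : Gset d iota g -> (forall z, f z <= g z) ->
      q (a *: f) <= a * intR mu (fun z => m z * g z).
    move=> Gg fg; have [cg _] := Gg; rewrite -(intRZ fin _ (bmf _ cg)).
    have -> : (fun z => a * (m z * g z)) = (fun z => m z * (a * g z)).
      by apply/funext => z; rewrite mulrCA.
    apply: q_le => //; first exact: GsetZ.
    by move=> z; rewrite ler_wpM2l.
  move: a0; rewrite le_eqVlt => /orP[/eqP a0|a0].
    by have [_ [g [Gg fg] _]] := ne f cf; have := qa g Gg fg; rewrite -a0 !mul0r.
  rewrite -ler_pdivrMl//; apply: le_q => // g Gg fg.
  by rewrite ler_pdivrMl//; exact: qa.
have [cg0 _] := Gg0.
have Sg0 : S (- g0) by exact: ctsN.
have [L [linL Lq Lg0]] := Hahn_Banach_sublinear lS sq Sg0.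
have b1m : bborel (fun z => 1 - m z) by apply: bborelB => //; exact: bborelC.
have b1mf f : continuous f -> bborel (fun z => (1 - m z) * f z) by move=> cf; apply: bborelM => //; exact: bb.
pose L' f := L f + intR mu (fun z => (1 - m z) * f z).
have L'lin : linear_on S L'.
  split=> [f g cf cg|a f cf]; rewrite /L'.
    rewrite (linL.1 _ _ cf cg).
    have -> : (fun z => (1 - m z) * (f + g) z) =
        (fun z => (1 - m z) * f z + (1 - m z) * g z) by apply/funext => z; rewrite -mulrDr.
    by rewrite (intRD fin (b1mf _ cf) (b1mf _ cg)) addrACA.
  rewrite (linL.2 _ _ cf).
  have -> : (fun z => (1 - m z) * (a *: f) z) =
      (fun z => a * ((1 - m z) * f z)) by apply/funext => z; rewrite mulrCA.
  by rewrite (intRZ fin _ (b1mf _ cf)) mulrDr.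
have LN f : continuous f -> L (- f) = - L f.
  by move=> cf; rewrite -scaleN1r linL.2// mulN1r.
have L'pos f : continuous f -> (forall z, 0 <= f z) -> 0 <= L' f.
  move=> cf f0; apply: addr_ge0; last first.
    apply: intR_ge0 => z; apply: mulr_ge0 => //.
    by have /andP[? ?] := m01 z; lra.
  (* The zero function lies in G above [- f], so [L (- f) <= q (- f) <= 0]. *)
  have := Lq (- f) (ctsN cf); rewrite LN//.
  have : q (- f) <= intR mu (fun z => m z * 0).
    apply: q_le; [exact: ctsN|exact: Gset_cst|].
    by move=> z; rewrite oppr_le0.
  have -> : (fun z => m z * 0) = (fun=> 0) by apply/funext => z; rewrite mulr0.
  by rewrite intRC mul0r; lra.
have split_m f : continuous f -> intR mu f = intR mu (fun z => m z * f z) + intR mu (fun z => (1 - m z) * f z).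
  move=> cf; rewrite -(intRD fin (bmf _ cf) (b1mf _ cf)).
  by congr intR; apply/funext => z; ring.
have [nu [rnu nuE]] := Riesz_representation hK cK L'lin L'pos.
have numu : preceq d iota nu mu.
  move=> g Gg; have [cg _] := Gg.
  rewrite (nuE _ cg) (integE fin (bb _ cg)) lee_fin (split_m _ cg) lerD2r.
  by rewrite (le_trans (Lq _ cg))// q_le.
(* Minimality at [g0] reads int m g0 <= [L g0] = [- q (- g0)]. Hence some g in G above [- g0] has
   int m g < - int m g0 + e. *)
have := mumin rnu numu Gg0.
rewrite (nuE _ cg0) (integE fin (bb _ cg0)) lee_fin (split_m _ cg0) lerD2r => h.
have hq : q (- g0) <= - intR mu (fun z => m z * g0 z).
  by rewrite -Lg0 LN// lerN2.
have [|_ [g [Gg gg0] <-] hg] := @inf_adherent R (above (- g0)) e e0.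
  split; first by apply: ne; exact: ctsN.
  exists (intR mu (fun z => m z * - g0 z)) => _ [g [[cg _] gg0] <-].
  by apply: imono => //; exact: ctsN.
exists g; split=> //; have [cg _] := Gg.
have -> : (fun z => m z * (g z + g0 z)) = (fun z => m z * g z + m z * g0 z).
  by apply/funext => z; rewrite mulrDr.
rewrite (intRD fin (bmf _ cg) (bmf _ cg0)).
by rewrite /q in hq; lra.
Qed.

End StoneCech.

Lemma exists_third {T : Type} (x y : T) :
  (exists a b c : T, [/\ a <> b, b <> c & a <> c]) -> exists u, x <> u /\ u <> y.
Proof.
move=> [a [b [c [ab bc ac]]]].
have [xa|xa] := pselect (a <> x /\ a <> y); first by exists a; split; [apply/nesym|]; case: xa.
have [xb|xb] := pselect (b <> x /\ b <> y); first by exists b; split; [apply/nesym|]; case: xb.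
exists c; split=> [xc|cy]; subst.
  apply: xa; split=> // ay; apply: xb; split=> // yb; exact: (ab (etrans ay (esym yb))).
apply: xa; split=> // ax; apply: xb; split=> // xb; exact: (ab (etrans ax (esym xb))).
Qed.

(** * Lipschitz functions with an explicit constant *)

Definition lip {R : realType} {T : Type} (d : T -> T -> R) (C : R) (f : T -> R) :=
  forall x y, `|f x - f y| <= C * d x y.

Section LipschitzFunctions.
Context {R : realType} {T : Type} {d : T -> T -> R}.
Hypothesis dm : is_metric d.

Lemma lip_weaken C C' f : C <= C' -> lip d C f -> lip d C' f.
Proof.
move=> CC' lf x y; rewrite (le_trans (lf x y))// ler_wpM2r//.
exact: (metric_ge0 dm).
Qed.

Lemma lip_cst C c : 0 <= C -> lip d C (fun=> c).
Proof. by move=> C0 x y; rewrite subrr normr0 mulr_ge0// (metric_ge0 dm). Qed.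

Lemma lipN C f : lip d C f -> lip d C (fun x => - f x).
Proof. by move=> lf x y; rewrite -opprD normrN lf. Qed.

Lemma lipM C C' B B' f g : lip d C f -> lip d C' g ->
  (forall x, `|f x| <= B) -> (forall x, `|g x| <= B') ->
  lip d (B * C' + B' * C) (fun x => f x * g x).
Proof.
move=> lf lg hB hB' x y.
have -> : f x * g x - f y * g y = f x * (g x - g y) + g y * (f x - f y) by ring.
rewrite (le_trans (ler_normD _ _))// !normrM mulrDl -!mulrA.
by apply: lerD; apply: ler_pM => //.
Qed.

Lemma lip_unif_cont C f : lip d C f -> unif_cont d f.
Proof.
move=> lf e e0; have C1 : 0 < `|C| + 1 by rewrite ltr_wpDl.
exists (e / (`|C| + 1)); first exact: divr_gt0.
move=> x y; rewrite ltr_pdivlMr// => h.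
rewrite (le_lt_trans (lf x y))// (le_lt_trans _ h)// mulrC ler_wpM2l//.
  exact: (metric_ge0 dm).
by rewrite (le_trans (ler_norm _))// lerDl.
Qed.

Lemma lip_dist a : lip d 1 (fun x => d x a).
Proof.
move=> x y; rewrite mul1r ler_norml.
have := metric_triangle dm x y a; have := metric_triangle dm y x a.
by rewrite (metric_sym dm y x) => ? ?; apply/andP; split; lra.
Qed.

Lemma lip_min C f g : lip d C f -> lip d C g ->
  lip d C (fun x => Num.min (f x) (g x)).
Proof.
move=> lf lg x y; have := lf x y; have := lg x y; rewrite !ler_norml.
move=> /andP[? ?] /andP[? ?].
by case: (leP (f x) (g x)) => ?; case: (leP (f y) (g y)) => ?; apply/andP; split; lra.
Qed.

End LipschitzFunctions.

(** * Slopes on the Stone-Cech compactification, and minimal measures tested on them *)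

Section DeLeeuw.
Context {R : realType} {T : Type} {d : T -> T -> R} {x0 : T}
  {K : ptopologicalType} {iota : T -> T -> K}
  {Phi : (T -> R) -> K -> R}.
Hypotheses (dm : is_metric d) (sc : is_stone_cech_tilde d iota).
Hypothesis PhiP : forall f, Lip0 d x0 f ->
     continuous (Phi f) /\
     forall x y, x <> y -> Phi f (iota x y) = (f x - f y) / d x y.
Implicit Types h : T -> R.

(* [Phi] without the normalisation h x0 = 0. *)
Definition slope h : K -> R := Phi (fun x => h x - h x0).

Lemma slope_Lip0 C h : lip d C h -> Lip0 d x0 (fun x => h x - h x0).
Proof.
move=> lh; split; first by rewrite subrr.
by exists C => x y; rewrite opprB addrA subrK lh.
Qed.

Lemma slope_cts C h : lip d C h -> continuous (slope h).
Proof. by move=> /slope_Lip0/PhiP[]. Qed.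

Lemma slopeE C h x y : lip d C h -> x <> y -> slope h (iota x y) = (h x - h y) / d x y.
Proof.
move=> /slope_Lip0/PhiP[_ E] xy.
by rewrite /slope E// opprB addrA subrK.
Qed.

Lemma slope_norm_iota C h x y : lip d C h -> x <> y -> `|slope h (iota x y)| <= C.
Proof.
move=> lh xy; rewrite (slopeE lh xy) normrM normfV.
have dxy := metric_gt0 dm xy.
by rewrite (gtr0_norm dxy) ler_pdivrMr// lh.
Qed.

Lemma slope_le C h z : lip d C h -> slope h z <= C.
Proof.
move=> lh; move: z; apply: (tilde_le sc); [exact: (slope_cts lh)|exact: ctsC|].
by move=> x y xy; exact: le_trans (ler_norm _) (slope_norm_iota lh xy).
Qed.

Lemma slope_ge C h z : lip d C h -> - C <= slope h z.
Proof.
move=> lh; move: z; apply: (tilde_le sc); [exact: ctsC|exact: (slope_cts lh)|].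
by move=> x y xy; have := slope_norm_iota lh xy; rewrite ler_norml => /andP[].
Qed.

Lemma slope_norm C h z : lip d C h -> `|slope h z| <= C.
Proof. by move=> lh; rewrite ler_norml slope_ge// slope_le. Qed.

Lemma slope_normalized f : f x0 = 0 -> slope f = Phi f.
Proof.
by move=> f0; congr Phi; apply/funext => x; rewrite f0 subr0.
Qed.

Section MinimalMeasure.
Variable mu : {measure set (borel K) -> \bar R}.
Hypotheses (rmu : radon mu) (mumin : preceq_minimal d iota mu).
Hypothesis T3 : exists a b c : T, [/\ a <> b, b <> c & a <> c].

(* For g in G, the infimal convolution h x = inf_u d(x, u) g(x, u), with the value 0 at
   u = x, satisfies h x - h y <= d(x, y) g(x, y), that is slope h <= g. *)
Lemma Gset_lipschitz_minorant (g g0 : K -> R) : Gset d iota g ->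
  (forall z, - g0 z <= g z) ->
  (forall x y, x <> y -> d x y * g0 (iota x y) <= 1) ->
  exists C h, [/\ lip d C h, forall x, -1 <= h x <= 0 & forall z, slope h z <= g z].
Proof.
move=> [cg Gg] g0g g01; have [_ cK _ _ _] := sc.
have [C C0 hC] := cts_bounded cK cg.
pose ga x u : R := if pselect (x = u) then 0 else d x u * g (iota x u).
have gaE x u : x <> u -> ga x u = d x u * g (iota x u) by rewrite /ga; case: pselect.
have gaxx x : ga x x = 0 by rewrite /ga; case: pselect.
have ga_ge x u : -1 <= ga x u.
  rewrite /ga; case: pselect => xu /=; first by rewrite lerN10.
  have := g01 _ _ xu; have := g0g (iota x u); have := metric_ge0 dm x u; nra.
(* G only constrains triples of distinct points, so a third point u is needed. Adding four of its
   inequalities on x, y, u cancels every term involving u and leaves twice the claim. *)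
have ga_sum x y : x <> y -> 0 <= ga x y + ga y x.
  move=> xy; have [u [xu uy]] := exists_third x y T3.
  have [yx ux yu] : [/\ y <> x, u <> x & y <> u] by split; apply/nesym.
  have := Gg _ _ _ xy yu xu; have := Gg _ _ _ uy yx ux.
  have := Gg _ _ _ ux xy uy; have := Gg _ _ _ yx xu yu.
  by rewrite -!gaE//; lra.
have ga_tri x y u : ga x u <= ga x y + ga y u.
  have [->|xy] := pselect (x = y); first by rewrite gaxx add0r.
  have [->|yu] := pselect (y = u); first by rewrite gaxx addr0.
  have [xu|xu] := pselect (x = u); first by rewrite -xu gaxx ga_sum.
  by rewrite !gaE//; exact: Gg.
have ga_le x y : ga x y <= C * d x y.
  rewrite /ga; case: pselect => /= [xy|xy]; first by rewrite xy (metric_refl dm) mulr0.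
  rewrite mulrC ler_wpM2r//; first exact: (metric_ge0 dm).
  exact: le_trans (ler_norm _) (hC _).
pose h x : R := inf [set ga x u | u in setT].
have h_le x u : h x <= ga x u.
  by apply: ge_inf; [exists (-1) => _ [v _ <-]; exact: ga_ge|exists u].
have le_h x c : (forall u, c <= ga x u) -> c <= h x.
  by move=> hc; apply: lb_le_inf; [exists (ga x x), x|move=> _ [v _ <-]; exact: hc].
have hxy x y : h x - h y <= ga x y.
  rewrite lerBlDr -lerBlDl; apply: (le_h y) => u.
  by rewrite lerBlDl (le_trans (h_le x u)).
have lh : lip d C h.
  move=> x y; rewrite ler_norml lerNl opprB.
  rewrite (le_trans (hxy y x))/= ?(le_trans (hxy x y))//.
  by rewrite (metric_sym dm x y).
exists C, h; split=> // [x|z].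
  by rewrite le_h//= -(gaxx x) h_le.
move: z; apply: (tilde_le sc) => //; first exact: (slope_cts lh).
move=> x y xy; rewrite (slopeE lh xy) ler_pdivrMr ?(metric_gt0 dm xy)//.
by rewrite mulrC -gaE.
Qed.

(** Take g in G above [- g0] with int m (g + g0) < e, and h with slope(h) <= g. Then int m g0 < e -
    int m g <= e - int m slope(h) <= e + c. *)
Lemma minimal_Gset_bound (m g0 : K -> R) c : bborel m -> (forall z, 0 <= m z <= 1) ->
  Gset d iota g0 -> (forall x y, x <> y -> d x y * g0 (iota x y) <= 1) ->
  (forall C h, lip d C h -> (forall x, -1 <= h x <= 0) ->
     - c <= intR mu (fun z => m z * slope h z)) ->
  intR mu (fun z => m z * g0 z) <= c.
Proof.
move=> bm m01 Gg0 g01 hc; apply/ler_addgt0Pr => e e0.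
have [_ cK _ _ _] := sc.
have fin : (mu setT < +oo)%E by have [] := rmu.
have bmf f : continuous f -> bborel (fun z => m z * f z).
  by move=> cf; apply: bborelM => //; exact: bborel_cts.
have [g [Gg g0g Ig]] := minimal_infimum dm sc rmu mumin bm m01 Gg0 e0.
have [C [h [lh h01 hg]]] := Gset_lipschitz_minorant Gg g0g g01.
have [[cg _] [cg0 _]] := (Gg, Gg0).
have := hc _ _ lh h01.
have : intR mu (fun z => m z * slope h z) <= intR mu (fun z => m z * g z).
  apply: (intR_le fin); [apply: bmf; exact: (slope_cts lh)|exact: bmf|].
  by move=> z; rewrite ler_wpM2l//; have /andP[] := m01 z.
have -> : intR mu (fun z => m z * g z) =
    intR mu (fun z => m z * (g z + g0 z)) - intR mu (fun z => m z * g0 z).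
  rewrite -(intRB fin); [|apply: bmf; exact: ctsD|exact: bmf].
  by congr intR; apply/funext => z; ring.
by lra.
Qed.

End MinimalMeasure.

End DeLeeuw.

(** * Extensions to the uniform compactification, and points of M in it *)

Section UniformExtension.
Context {R : realType} {T : Type} {d : T -> T -> R}
  {U : ptopologicalType} {j : T -> U}.
Hypotheses (dm : is_metric d) (uc : is_uniform_compactification d j).
Implicit Types h k : T -> R.

Definition uext h : U -> R := get [set g : U -> R | continuous g /\ forall x, g (j x) = h x].

Lemma uextP C B h : lip d C h -> (forall x, `|h x| <= B) ->
  continuous (uext h) /\ forall x, uext h (j x) = h x.
Proof.
move=> lh hB; have [_ _ _ ext _] := uc.
have [g gP] := ext h (ex_intro _ B hB) (lip_unif_cont dm lh).
by apply: (@getPex _ [set g : U -> R | continuous g /\ forall x, g (j x) = h x]); exists g.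
Qed.

Lemma uniform_le (f g : U -> R) : continuous f -> continuous g ->
  (forall x, f (j x) <= g (j x)) -> forall u, f u <= g u.
Proof.
have [_ _ dense _ _] := uc => cf cg fg u.
have cl : closed [set u | 0 <= g u - f u] by apply: cts_closed_ge; exact: ctsB.
rewrite -subr_ge0; apply: cl.
have : closure (range j) u by rewrite dense.
by apply: closureS => _ [x _ <-] /=; rewrite subr_ge0 fg.
Qed.

Lemma uniform_eq (f g : U -> R) : continuous f -> continuous g ->
  (forall x, f (j x) = g (j x)) -> forall u, f u = g u.
Proof.
move=> cf cg fg u; apply/eqP; rewrite eq_le.
by rewrite !uniform_le// => x; rewrite fg.
Qed.

Lemma norm_le1_01 (a : R) : 0 <= a <= 1 -> `|a| <= 1.
Proof. by move=> /andP[? ?]; rewrite ler_norml; apply/andP; split; lra. Qed.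

(** The cap at 1 keeps the distance bounded, as extension to [U] requires. *)
Fixpoint trunc_dist (l : seq T) (x : T) : R :=
  if l is a :: l' then Num.min (d x a) (trunc_dist l' x) else 1.

Lemma trunc_dist01 l x : 0 <= trunc_dist l x <= 1.
Proof.
elim: l => [|a l /andP[IH1 IH2]] /=; first by rewrite ler01 lexx.
by rewrite le_min (metric_ge0 dm) IH1 ge_min IH2 orbT.
Qed.

Lemma trunc_dist_lip l : lip d 1 (trunc_dist l).
Proof.
elim: l => [|a l IH] /=; first exact: (lip_cst dm _ ler01).
by apply: lip_min => //; exact: lip_dist.
Qed.

Lemma trunc_dist_uextP l : continuous (uext (trunc_dist l)) /\
  forall x, uext (trunc_dist l) (j x) = trunc_dist l x.
Proof.
by apply: (uextP (trunc_dist_lip l)) => x; exact: norm_le1_01 (trunc_dist01 l x).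
Qed.

Lemma trunc_dist_cat l1 l2 x : trunc_dist (l1 ++ l2) x <= trunc_dist l2 x.
Proof. by elim: l1 => //= a l IH; rewrite ge_min IH orbT. Qed.

Lemma trunc_dist_vanish l1 l2 : all (fun a => trunc_dist (l1 ++ l2) a == 0) l1.
Proof.
elim: l1 => //= a l IH; apply/andP; split.
  rewrite (metric_refl dm) min_l//.
  by have /andP[] := trunc_dist01 (l ++ l2) a.
by apply: sub_all IH => b /eqP ->; rewrite min_r// (metric_ge0 dm).
Qed.

Lemma trunc_dist_zero_bounded x0 l :
  exists r, forall x, trunc_dist l x = 0 -> d x x0 <= r.
Proof.
elim: l => [|a l [r IH]] /=.
  by exists 0 => x /eqP; rewrite oner_eq0.
exists (Num.max (d a x0) r) => x; case: (leP (d x a) (trunc_dist l x)) => _.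
  by have [h _ _] := dm => /h ->; rewrite le_max lexx.
by move=> /IH h; rewrite le_max h orbT.
Qed.

(** Extension commutes with finite minima, so a single point of [l] already gives the small value;
    [e <= 1] rules out the cap. *)
Lemma trunc_dist_small l u (e : R) : e <= 1 -> uext (trunc_dist l) u < e ->
  exists a, uext (trunc_dist [:: a]) u < e.
Proof.
elim: l => [|a l IH] e1 ue.
  have [cu uE] := trunc_dist_uextP [::].
  have E : uext (trunc_dist [::]) u = 1.
    exact: (uniform_eq cu (@ctsC R U 1) uE).
  by move: ue; rewrite E ltNge e1.
have E : uext (trunc_dist (a :: l)) u =
    Num.min (uext (trunc_dist [:: a]) u) (uext (trunc_dist l) u).
  have [c1 E1] := trunc_dist_uextP (a :: l).
  have [c2 E2] := trunc_dist_uextP [:: a].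
  have [c3 E3] := trunc_dist_uextP l.
  apply: (uniform_eq c1 (cts_min c2 c3)) => x; rewrite E1 E2 E3 /= -minA; congr Num.min.
  by rewrite min_r//; have /andP[] := trunc_dist01 l x.
by move: ue; rewrite E gt_min => /orP[h|/(IH e1)//]; exists a.
Qed.

(** Any neighbourhood of [u] meets the image of the ball of radius 1/(n+1) about a_n. Two such balls
    meet when looked at near [u], so (a_n) is Cauchy. With l its limit, every neighbourhood of [u]
    meets every neighbourhood of [j l], and [U] is Hausdorff. *)
Lemma complete_point u : complete_metric d ->
  (forall e, 0 < e -> e <= 1 -> exists a, uext (trunc_dist [:: a]) u < e) ->
  exists x, u = j x.
Proof.
move=> cM small; have [[hU cU] jcont dense _ _] := uc.
have e1 n : 0 < n.+1%:R^-1 :> R by rewrite invr_gt0.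
have e2 n : n.+1%:R^-1 <= 1 :> R by rewrite invf_le1 ?ler1n.
have /choice[a ha] := fun n => small _ (e1 n) (e2 n).
have near_u l (e : R) (V : set U) : uext (trunc_dist [:: l]) u < e -> e <= 1 -> nbhs u V ->
    exists x, V (j x) /\ d x l < e.
  move=> ue le1 nV; have [cu uE] := trunc_dist_uextP [:: l].
  have : closure (range j) u by rewrite dense.
  have oW : nbhs u [set v | uext (trunc_dist [:: l]) v < e].
    by apply: open_nbhs_nbhs; split=> //; exact: cts_open_lt.
  move=> /(_ _ (filterI nV oW))[_ [[x _ <-] [Vx /=]]].
  rewrite uE /= gt_min => /orP[xl|]; first by exists x.
  by rewrite ltNge le1.
have dist_a n m : d (a n) (a m) < n.+1%:R^-1 + m.+1%:R^-1.
  have [cu uE] := trunc_dist_uextP [:: a m].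
  have oW : nbhs u [set v | uext (trunc_dist [:: a m]) v < m.+1%:R^-1].
    by apply: open_nbhs_nbhs; split; [exact: cts_open_lt|exact: ha].
  have [x [/= + xn]] := near_u _ _ _ (ha n) (e2 n) oW.
  rewrite uE /= gt_min => /orP[xm|]; last by rewrite ltNge e2.
  rewrite (le_lt_trans (metric_triangle dm (a n) x (a m)))//.
  by rewrite (metric_sym dm (a n) x) ltrD.
have arch (e : R) : 0 < e -> exists N, forall n, (N <= n)%N -> n.+1%:R^-1 < e.
  move=> e0; exists (Num.truncn e^-1) => n Nn.
  rewrite invf_plt ?posrE//; apply: lt_le_trans (truncnS_gt _) _.
  by rewrite ler_nat ltnS.
have [l hl] : exists l, forall e : R, 0 < e -> exists N, forall n, (N <= n)%N -> d (a n) l < e.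
  apply: cM => e e0; have [N hN] := arch (e / 2) (divr_gt0 e0 (ltr0Sn R 1)).
  by exists N => m n Nm Nn; rewrite (lt_trans (dist_a m n))// [e]splitr ltrD// hN.
exists l; apply: hU => V W nV nW; rewrite /=.
have [del del0 hdel] := jcont _ _ nW.
have [N1 h1] := hl (del / 2) (divr_gt0 del0 (ltr0Sn R 1)).
have [N2 h2] := arch (del / 2) (divr_gt0 del0 (ltr0Sn R 1)).
pose n := maxn N1 N2.
have [x [Vx xn]] := near_u _ _ _ (ha n) (e2 n) nV.
exists (j x); split=> //; apply: hdel.
rewrite (le_lt_trans (metric_triangle dm l (a n) x))// [del]splitr ltrD//.
  by rewrite (metric_sym dm l) h1// leq_maxl.
by rewrite (metric_sym dm (a n)) (lt_trans xn)// h2// leq_maxr.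
Qed.

End UniformExtension.

(** * The distance and its inverse on the Stone-Cech compactification *)

Section DistanceRatio.
Context {R : realType} {T : Type} {d : T -> T -> R} {K : ptopologicalType}
  {iota : T -> T -> K}.
Hypotheses (dm : is_metric d) (sc : is_stone_cech_tilde d iota).

(** The distance may be unbounded, while d / (1 + d) is bounded and continuous. The values 0 and 1
    of its extension stand for distance 0 and infinity, and 1 - D for 1 / (1 + d). *)
Lemma exists_distance_ratio : exists D : K -> R, continuous D /\
  forall x y, x <> y -> D (iota x y) = d x y / (1 + d x y).
Proof.
have [_ _ _ _ ext] := sc.
have d0 x y : 0 <= d x y := metric_ge0 dm x y.
apply: (ext (fun x y => d x y / (1 + d x y))).
  exists 1 => x y _; rewrite ger0_norm ?divr_ge0 ?addr_ge0//.
  by rewrite ler_pdivrMr ?mul1r ?lerDr ?ltr_pwDl.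
move=> x y _ e e0; exists (e / 2); first exact: divr_gt0.
move=> x' y' _ xx yy.
have p1 : 0 < 1 + d x y by rewrite ltr_pwDl.
have p2 : 0 < 1 + d x' y' by rewrite ltr_pwDl.
have -> : d x' y' / (1 + d x' y') - d x y / (1 + d x y) =
    (d x' y' - d x y) / ((1 + d x' y') * (1 + d x y)).
  by field; rewrite !gt_eqF.
have p12 : 1 <= (1 + d x' y') * (1 + d x y).
  by have := d0 x y; have := d0 x' y'; nra.
rewrite normrM normfV (ger0_norm (le_trans ler01 p12)) ltr_pdivrMr ?(lt_le_trans ltr01)//.
apply: (@lt_le_trans _ _ e); last by rewrite ler_peMr// ltW.
have := metric_triangle dm x x' y; have := metric_triangle dm x' y' y.
have := metric_triangle dm x' x y'; have := metric_triangle dm x y y'.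
rewrite (metric_sym dm x' x) (metric_sym dm y' y) ltr_norml => ? ? ? ?.
by apply/andP; split; lra.
Qed.

Variable D : K -> R.
Hypotheses (cD : continuous D)
  (DE : forall x y, x <> y -> D (iota x y) = d x y / (1 + d x y)).

Lemma ratio_ge0 z : 0 <= D z.
Proof.
move: z; apply: (tilde_le sc (@ctsC R K 0) cD) => x y xy.
by rewrite DE// divr_ge0 ?addr_ge0// (metric_ge0 dm).
Qed.

Lemma ratio_le1 z : D z <= 1.
Proof.
move: z; apply: (tilde_le sc cD (@ctsC R K 1)) => x y xy.
rewrite DE// ler_pdivrMr ?mul1r ?lerDr// ltr_pwDl// (metric_ge0 dm) //.
Qed.

(* The continuous extension of 1 / (a + d). *)
Definition inv_dist (a : R) (z : K) : R := (1 - D z) / (a * (1 - D z) + D z).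

Lemma inv_dist_den a z : 0 < a -> 0 < a * (1 - D z) + D z.
Proof.
move=> a0; have := ratio_ge0 z; have := ratio_le1 z.
rewrite le_eqVlt => /orP[/eqP ->|D1] D0; first by rewrite subrr mulr0 add0r.
by rewrite ltr_wpDr// mulr_gt0// subr_gt0.
Qed.

Lemma inv_dist_cts a : 0 < a -> continuous (inv_dist a).
Proof.
move=> a0; have c1 : continuous (fun z => 1 - D z) by apply: ctsB => //; exact: ctsC.
apply: ctsM => //; apply: ctsV; last by move=> z; rewrite gt_eqF// inv_dist_den.
by apply: ctsD => //; apply: ctsM => //; exact: ctsC.
Qed.

Lemma inv_dist_iota a x y : 0 < a -> x <> y -> inv_dist a (iota x y) = (a + d x y)^-1.
Proof.
move=> a0 xy; rewrite /inv_dist DE//; have := metric_ge0 dm x y => d0.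
have p1 : 1 + d x y != 0 by rewrite gt_eqF// ltr_pwDl.
have p2 : a + d x y != 0 by rewrite gt_eqF// ltr_wpDr.
by field; rewrite p1 p2.
Qed.

Lemma inv_dist_ge0 a z : 0 < a -> 0 <= inv_dist a z.
Proof.
by move=> a0; rewrite divr_ge0 ?subr_ge0 ?ratio_le1// ltW// inv_dist_den.
Qed.

Lemma inv_dist_anti a b z : 0 < a -> a <= b -> inv_dist b z <= inv_dist a z.
Proof.
move=> a0 ab; have b0 : 0 < b by exact: lt_le_trans ab.
have D1 : 0 <= 1 - D z by rewrite subr_ge0 ratio_le1.
rewrite ler_wpM2l// lef_pV2 ?posrE ?inv_dist_den//.
by rewrite lerD2r ler_wpM2r.
Qed.

Lemma inv_dist_at0 a z : D z = 0 -> inv_dist a z = a^-1.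
Proof. by rewrite /inv_dist => ->; rewrite subr0 mulr1 addr0 mul1r. Qed.

Lemma inv_dist1 z : inv_dist 1 z = 1 - D z.
Proof. by rewrite /inv_dist mul1r subrK divr1. Qed.

(** The function t / (a + t) = 1 - a / (a + t) is increasing and subadditive in t >= 0. *)
Lemma inv_dist_Gset a : 0 < a -> Gset d iota (inv_dist a).
Proof.
move=> a0; split; first exact: inv_dist_cts.
move=> x u y xu uy xy; rewrite !inv_dist_iota//.
have := metric_triangle dm x u y; move: (metric_gt0 dm xu) (metric_gt0 dm uy) (metric_gt0 dm xy).
move: (d x y) (d x u) (d u y) => r s t s0 t0 r0 rst.
have E v : 0 < v -> v * (a + v)^-1 = 1 - a * (a + v)^-1.
  by move=> v0; field; rewrite gt_eqF// addr_gt0.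
apply: (@le_trans _ _ ((s + t) * (a + (s + t))^-1)).
  rewrite !E ?addr_gt0// lerD2l lerN2; apply: ler_wpM2l; first exact: ltW.
  by rewrite lef_pV2 ?posrE ?addr_gt0// lerD2l.
rewrite mulrDl lerD//; (apply: ler_wpM2l; first exact: ltW);
  by rewrite lef_pV2 ?posrE ?addr_gt0// lerD2l ?lerDl ?lerDr ltW.
Qed.

Lemma dist_inv_dist_le1 a x y : 0 < a -> x <> y -> d x y * inv_dist a (iota x y) <= 1.
Proof.
move=> a0 xy; rewrite inv_dist_iota//; have d0 := metric_gt0 dm xy.
by rewrite ler_pdivrMr ?addr_gt0// mul1r lerDr ltW.
Qed.

Lemma inv_dist_cvg z : D z != 0 ->
  (fun n : nat => inv_dist n.+1%:R^-1 z) @ \oo --> (1 - D z) / D z.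
Proof.
move=> Dz; apply: cvgM; first exact: cvg_cst.
apply: cvgV => //; rewrite -[X in _ --> X]add0r; apply: cvgD; last exact: cvg_cst.
rewrite -[X in _ --> X](mul0r (1 - D z)); apply: cvgM; last exact: cvg_cst.
exact: cvg_harmonic.
Qed.

End DistanceRatio.

(** * Algebraic identities between slopes and coordinate extensions *)

Section SlopeIdentities.
Context {R : realType} {T : Type} {d : T -> T -> R} {x0 : T}
  {K : ptopologicalType} {iota : T -> T -> K} {U : ptopologicalType} {j : T -> U}
  {p1 p2 : K -> U} {Phi : (T -> R) -> K -> R}.
Hypotheses (dm : is_metric d) (sc : is_stone_cech_tilde d iota)
  (uc : is_uniform_compactification d j).
Hypotheses (cp1 : continuous p1) (cp2 : continuous p2).
Hypothesis pE : forall x y, x <> y -> p1 (iota x y) = j x /\ p2 (iota x y) = j y.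
Hypothesis PhiP : forall f, Lip0 d x0 f ->
     continuous (Phi f) /\
     forall x y, x <> y -> Phi f (iota x y) = (f x - f y) / d x y.
Implicit Types h k : T -> R.

Local Notation slope := (@slope R T x0 K Phi).

Local Notation uext := (@uext R T U j).

Definition fst_ext h (z : K) : R := uext h (p1 z).
Definition snd_ext h (z : K) : R := uext h (p2 z).

Lemma fst_ext_cts C B h : lip d C h -> (forall x, `|h x| <= B) -> continuous (fst_ext h).
Proof.
move=> lh hB z; have [cu _] := uextP dm uc lh hB.
by apply: continuous_comp; [exact: cp1|exact: cu].
Qed.

Lemma snd_ext_cts C B h : lip d C h -> (forall x, `|h x| <= B) -> continuous (snd_ext h).
Proof.
move=> lh hB z; have [cu _] := uextP dm uc lh hB.
by apply: continuous_comp; [exact: cp2|exact: cu].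
Qed.

Lemma fst_extE C B h x y : lip d C h -> (forall x, `|h x| <= B) -> x <> y ->
  fst_ext h (iota x y) = h x.
Proof.
by move=> lh hB xy; have [_ E] := uextP dm uc lh hB; rewrite /fst_ext (pE xy).1 E.
Qed.

Lemma snd_extE C B h x y : lip d C h -> (forall x, `|h x| <= B) -> x <> y ->
  snd_ext h (iota x y) = h y.
Proof.
by move=> lh hB xy; have [_ E] := uextP dm uc lh hB; rewrite /snd_ext (pE xy).2 E.
Qed.

Lemma fst_ext_le C B C' B' h k z : lip d C h -> (forall x, `|h x| <= B) ->
  lip d C' k -> (forall x, `|k x| <= B') -> (forall x, h x <= k x) ->
  fst_ext h z <= fst_ext k z.
Proof.
move=> lh hB lk kB hk; have [c1 E1] := uextP dm uc lh hB.
have [c2 E2] := uextP dm uc lk kB.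
by apply: (uniform_le uc c1 c2) => x; rewrite E1 E2.
Qed.

Lemma snd_ext_le C B C' B' h k z : lip d C h -> (forall x, `|h x| <= B) ->
  lip d C' k -> (forall x, `|k x| <= B') -> (forall x, h x <= k x) ->
  snd_ext h z <= snd_ext k z.
Proof.
move=> lh hB lk kB hk; have [c1 E1] := uextP dm uc lh hB.
have [c2 E2] := uextP dm uc lk kB.
by apply: (uniform_le uc c1 c2) => x; rewrite E1 E2.
Qed.

Lemma ext_bounds C B h a b z : lip d C h -> (forall x, `|h x| <= B) ->
  (forall x, a <= h x <= b) -> (a <= fst_ext h z <= b) /\ (a <= snd_ext h z <= b).
Proof.
move=> lh hB hab; have [c1 E1] := uextP dm uc lh hB.
have lo u : a <= uext h u.
  by apply: (uniform_le uc (@ctsC R U a) c1) => x; rewrite E1; have /andP[] := hab x.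
have hi u : uext h u <= b.
  by apply: (uniform_le uc c1 (@ctsC R U b)) => x; rewrite E1; have /andP[] := hab x.
by rewrite /fst_ext /snd_ext !lo !hi.
Qed.

(** This is d slope(h) = h(x) - h(y) divided by 1 + d, so that both sides extend continuously. At
    distance infinity ([D z = 1]) it says that a bounded h has slope 0. *)
Lemma slope_ratio (D : K -> R) C B h z : continuous D ->
  (forall x y, x <> y -> D (iota x y) = d x y / (1 + d x y)) ->
  lip d C h -> (forall x, `|h x| <= B) ->
  D z * slope h z = (1 - D z) * (fst_ext h z - snd_ext h z).
Proof.
move=> cD DE lh hB; have c1 := fst_ext_cts lh hB; have c2 := snd_ext_cts lh hB.
move: z; apply: (tilde_eq sc).
- by apply: ctsM => //; exact: (slope_cts PhiP lh).
- by apply: ctsM; apply: ctsB => //; exact: ctsC.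
move=> x y xy; rewrite DE// (slopeE PhiP lh xy) (fst_extE lh hB xy) (snd_extE lh hB xy).
have dp := metric_gt0 dm xy.
by field; rewrite !gt_eqF// addr_gt0.
Qed.

(** The Leibniz rule in symmetric form: the coefficient of each slope is a sum over both
    coordinates, whence the shape of the weight m. *)
Lemma slope_mul C B C' B' h k z : lip d C h -> (forall x, `|h x| <= B) ->
  lip d C' k -> (forall x, `|k x| <= B') ->
  2 * slope (fun x => k x * h x) z =
  (fst_ext k z + snd_ext k z) * slope h z + (fst_ext h z + snd_ext h z) * slope k z.
Proof.
move=> lh hB lk kB; have lkh := lipM lk lh kB hB.
have := (fst_ext_cts lh hB, snd_ext_cts lh hB, fst_ext_cts lk kB, snd_ext_cts lk kB).
move=> [[[c1 c2] c3] c4].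
have cs h' C'' : lip d C'' h' -> continuous (slope h') by exact: (slope_cts PhiP).
move: z; apply: (tilde_eq sc).
- by apply: ctsM; [exact: ctsC|exact: cs lkh].
- by apply: ctsD; apply: ctsM; [exact: ctsD|exact: cs lh|exact: ctsD|exact: cs lk].
move=> x y xy; rewrite (slopeE PhiP lkh xy) (slopeE PhiP lh xy) (slopeE PhiP lk xy).
rewrite (fst_extE lh hB xy) (snd_extE lh hB xy) (fst_extE lk kB xy) (snd_extE lk kB xy).
by field; rewrite gt_eqF// (metric_gt0 dm).
Qed.

Lemma ext_mul C B C' B' h k z : lip d C h -> (forall x, `|h x| <= B) ->
  lip d C' k -> (forall x, `|k x| <= B') ->
  fst_ext (fun x => k x * h x) z = fst_ext k z * fst_ext h z /\
  snd_ext (fun x => k x * h x) z = snd_ext k z * snd_ext h z.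
Proof.
move=> lh hB lk kB; have lkh := lipM lk lh kB hB.
have khB x : `|k x * h x| <= B' * B by rewrite normrM ler_pM.
have [c1 E1] := uextP dm uc lkh khB.
have [c2 E2] := uextP dm uc lh hB.
have [c3 E3] := uextP dm uc lk kB.
have E u : uext (fun x => k x * h x) u = uext k u * uext h u.
  by apply: (uniform_eq uc c1 (ctsM c3 c2)) => x; rewrite E1 E2 E3.
by rewrite /fst_ext /snd_ext !E.
Qed.

Lemma slopeD_scale C C' h k (a b : R) z : lip d C h -> lip d C' k ->
  lip d (`|a| * C + `|b| * C') (fun x => a * h x + b * k x) /\
  slope (fun x => a * h x + b * k x) z = a * slope h z + b * slope k z.
Proof.
move=> lh lk.
have l : lip d (`|a| * C + `|b| * C') (fun x => a * h x + b * k x).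
  move=> x y; rewrite opprD addrACA -!mulrBr mulrDl -!mulrA.
  by rewrite (le_trans (ler_normD _ _))// !normrM lerD// ler_wpM2l.
split=> //; move: z; apply: (tilde_eq sc).
- exact: (slope_cts PhiP l).
- by apply: ctsD; apply: ctsM; try exact: ctsC; [exact: (slope_cts PhiP lh)|exact: (slope_cts PhiP lk)].
move=> x y xy; rewrite (slopeE PhiP l xy) (slopeE PhiP lh xy) (slopeE PhiP lk xy).
by field; rewrite gt_eqF// (metric_gt0 dm).
Qed.

End SlopeIdentities.

(** * Consequences of optimality and of membership in F(M) *)

Section OptimalRepresentation.
Context {R : realType} {T : Type} {d : T -> T -> R} {x0 : T}
  {K : ptopologicalType} {iota : T -> T -> K} {U : ptopologicalType} {j : T -> U}
  {p1 p2 : K -> U} {Phi : (T -> R) -> K -> R}.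
Hypotheses (dm : is_metric d) (sc : is_stone_cech_tilde d iota)
  (uc : is_uniform_compactification d j).
Hypotheses (cp1 : continuous p1) (cp2 : continuous p2).
Hypothesis pE : forall x y, x <> y -> p1 (iota x y) = j x /\ p2 (iota x y) = j y.
Hypothesis PhiP : forall f, Lip0 d x0 f ->
     continuous (Phi f) /\
     forall x y, x <> y -> Phi f (iota x y) = (f x - f y) / d x y.
Variable mu : {measure set (borel K) -> \bar R}.
Hypothesis rmu : radon mu.
Implicit Types f h k : T -> R.

Local Notation slope := (@slope R T x0 K Phi).

Let cK : compact [set: K]. Proof. by case: sc. Qed.
Let fin : (mu setT < +oo)%E. Proof. by case: rmu. Qed.

Lemma ball_lip f : Lip0_ball d x0 f -> f x0 = 0 /\ lip d 1 f.
Proof. by move=> [f0 lf]; split=> // x y; rewrite mul1r; exact: lf. Qed.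

Lemma slopeZ C (a : R) h : lip d C h ->
  lip d (`|a| * C) (fun x => a * h x) /\ slope (fun x => a * h x) = fun z => a * slope h z.
Proof.
move=> lh.
have E : (fun x => a * h x) = (fun x => a * h x + 0 * h x).
  by apply/funext => x; rewrite mul0r addr0.
have h0 z := slopeD_scale dm sc PhiP a 0 z lh lh.
split; rewrite E; first by have [] := h0 point; rewrite normr0 mul0r addr0.
by apply/funext => z; have [_ ->] := h0 z; rewrite mul0r addr0.
Qed.

Lemma bborel_slope C h : lip d C h -> bborel (slope h).
Proof. by move=> lh; apply: bborel_cts => //; exact: (slope_cts PhiP lh). Qed.

Lemma all_vanish_sum (f g : T -> R) (s : seq (R * T)) :
  (forall x, g x = 0 -> f x = 0) -> all (fun a => g a == 0) (map snd s) ->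
  \sum_(ax <- s) ax.1 * f ax.2 = 0.
Proof.
move=> gf; elim: s => [|[b a] s IH] /=; first by rewrite big_nil.
by move=> /andP[/eqP ga /IH]; rewrite big_cons/= (gf _ ga) mulr0 add0r.
Qed.

Hypothesis muF : forall e : R, 0 < e -> exists s : seq (R * T),
  forall f, Lip0_ball d x0 f ->
    (`| integ mu (Phi f) - (\sum_(ax <- s) ax.1 * f ax.2)%:E | <= e%:E)%E.

(** [l n] collects [x0] and the points of the first n + 1 approximating sums, the last of which is
    accurate to 1/(n+1). That sum does not see a function vanishing on [l n], and division by C
    brings the function into the unit ball. *)
Lemma free_space_cutoffs : exists l : nat -> seq T,
  [/\ forall n x, @trunc_dist R T d (l n.+1) x <= @trunc_dist R T d (l n) x,
      forall n, @trunc_dist R T d (l n) x0 = 0 &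
      forall n C f, 0 < C -> lip d C f ->
        (forall x, @trunc_dist R T d (l n) x = 0 -> f x = 0) ->
        `|intR mu (slope f)| <= C / n.+1%:R].
Proof.
have e1 n : 0 < n.+1%:R^-1 :> R by rewrite invr_gt0.
have /choice[s hs] := fun n => muF (e1 n).
pose fix l n : seq T :=
  if n is n'.+1 then map snd (s n) ++ l n' else map snd (s 0%N) ++ [:: x0].
have l0 n : @trunc_dist R T d (l n) x0 = 0.
  have h0 l' : 0 <= @trunc_dist R T d l' x0 by have /andP[] := trunc_dist01 dm l' x0.
  apply/eqP; rewrite eq_le h0 andbT.
  elim: n => [|n IH] /=; rewrite (le_trans (trunc_dist_cat _ _ _))//=.
  by rewrite (metric_refl dm) ge_min lexx.
have lv n : all (fun a => @trunc_dist R T d (l n) a == 0) (map snd (s n)).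
  by case: n => [|n] /=; exact: trunc_dist_vanish.
exists l; split=> // [n x|n C f C0 lf fl]; first exact: trunc_dist_cat.
have [lZ sZ] := slopeZ C^-1 lf.
have f0 : C^-1 * f x0 = 0 by rewrite fl ?mulr0.
have ball : Lip0_ball d x0 (fun x => C^-1 * f x).
  split=> // x y; rewrite (le_trans (lZ x y))//.
  by rewrite gtr0_norm ?invr_gt0// mulVf ?mul1r// gt_eqF.
have := hs n _ ball; rewrite -(@slope_normalized R T x0 K Phi _ f0) sZ.
have bs := bborel_slope lf.
rewrite (@all_vanish_sum (fun x => C^-1 * f x) _ _ _ (lv n)); last first.
  by move=> x xl; rewrite fl// mulr0.
rewrite (integE fin); last by apply: bborelM => //; exact: bborelC.
rewrite (intRZ fin)// sube0 lee_fin normrM normfV (gtr0_norm C0).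
by rewrite ler_pdivrMl.
Qed.

Hypothesis muopt : mu [set: borel K] =
  ereal_sup [set r | exists2 f, Lip0_ball d x0 f & r = `| integ mu (Phi f) |%E].

Lemma almost_optimal (e : R) : 0 < e ->
  exists2 f, Lip0_ball d x0 f & intR mu (fun z => 1 - slope f z) <= e.
Proof.
move=> e0.
have finm : mu setT \is a fin_num by rewrite ge0_fin_numE.
have finS : ereal_sup [set r | exists2 f, Lip0_ball d x0 f & r = `| integ mu (Phi f) |%E] \is a fin_num.
  by rewrite -muopt.
have [_ [f Bf ->]] := ub_ereal_sup_adherent e0 finS.
rewrite -muopt; have [f0 lf] := ball_lip Bf.
have bs := bborel_slope lf.
rewrite -(@slope_normalized R T x0 K Phi _ f0) (integE fin bs) -(fineK finm) /= -EFinB lte_fin => hf.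
have I1 g : bborel g -> intR mu (fun z => 1 - g z) = fine (mu setT) - intR mu g.
  by move=> bg; rewrite (intRB fin)// ?intRC ?mul1r//; exact: bborelC.
have [I0|I0] := leP 0 (intR mu (slope f)).
  by exists f => //; rewrite I1//; move: hf; rewrite ger0_norm//; lra.
(* The supremum runs over absolute values, so a negative integral is treated by passing to -f. *)
have [lN sN] := slopeZ (-1) lf.
exists (fun x => -1 * f x).
  split; first by rewrite f0 mulr0.
  by move=> x y; rewrite (le_trans (lN x y))// normrN1 !mul1r.
rewrite sN I1; last by apply: bborelM => //; exact: bborelC.
by rewrite (intRZ fin)//; move: hf; rewrite ltr0_norm//; lra.
Qed.

(* If f nearly attains the norm, so does f minus its truncation at height r up to an error:
   the truncation does not contribute where d is infinite, while f minus the truncation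
   vanishes on any prescribed finite set, so its pairing with an element of F(M) is small. *)
Lemma ratio1_null (D : K -> R) : continuous D ->
  (forall x y, x <> y -> D (iota x y) = d x y / (1 + d x y)) ->
  measurable ([set z | D z = 1] : set (borel K)) /\ mu [set z | D z = 1] = 0%E.
Proof.
move=> cD DE.
have mD : measurable ([set z | D z = 1] : set (borel K)).
  by apply: closed_borel; exact: cts_closed_eq.
split=> //.
have [l [_ l0 hl]] := free_space_cutoffs.
suff : fine (mu [set z | D z = 1]) <= 0.
  move=> h; have finm : mu [set z | D z = 1] \is a fin_num.
    by rewrite ge0_fin_numE// (le_lt_trans _ fin)// le_measure ?inE.
  by apply/eqP; rewrite eq_le measure_ge0 andbT -(fineK finm) lee_fin.
rewrite -(intR_indic mu mD); apply/ler_addgt0Pr => e e0; rewrite add0r.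
have e2 : 0 < e / 2 by exact: divr_gt0.
have [f Bf If] := almost_optimal e2.
(* The 2 is a Lipschitz constant of f minus its truncation. *)
have [n hn] : exists n : nat, 2 / n.+1%:R <= e / 2 :> R.
  exists (Num.truncn (2 / (e / 2))); rewrite ler_pdivrMr// mulrC -ler_pdivrMr//.
  exact/ltW/truncnS_gt.
have [f0 lf] := ball_lip Bf.
have [r hr] := trunc_dist_zero_bounded dm x0 (l n).
pose r' := Num.max r 0.
(* The truncation of f to [-r', r']; it equals f at the points of [l n], where |f| <= d(., x0) <=
   r'. *)
pose c x := - Num.min r' (- Num.min (f x) r').
have r0 : 0 <= r' by rewrite le_max lexx orbT.
have lc : lip d 1 c.
  by apply/lipN/lip_min; [|apply/lipN/lip_min => //]; exact: lip_cst.
have cE x : `|c x| <= r' /\ (`|f x| <= r' -> c x = f x).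
  rewrite /c !ler_norml; case: (leP (f x) r') => h1.
    case: (leP r' (- f x)) => h2; by split=> [|/andP[h3 h4]]; [apply/andP; split; lra|lra].
  rewrite min_r; last by lra.
  by split=> [|/andP[h3 h4]]; [apply/andP; split; lra|lra].
have cB x : `|c x| <= r' by have [] := cE x.
pose h x := 1 * f x + (-1) * c x.
have [lh _] := slopeD_scale dm sc PhiP 1 (-1) point lf lc.
have sh z : slope h z = slope f z - slope c z.
  by have [_ ->] := slopeD_scale dm sc PhiP 1 (-1) z lf lc; rewrite mul1r mulN1r.
have lh2 : lip d 2 h.
  by apply: lip_weaken lh => //; rewrite normrN1 normr1 !mul1r.
have hvan x : trunc_dist (d := d) (l n) x = 0 -> h x = 0.
  move=> /hr dx; rewrite /h (cE x).2 ?mul1r ?mulN1r ?subrr//.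
  by have := lf x x0; rewrite f0 subr0 mul1r => /le_trans; apply; rewrite le_max dx.
have := hl n _ _ (ltr0Sn R 1) lh2 hvan; rewrite ler_norml => /andP[_ Ih].
have bsf := bborel_slope lf; have bsh := bborel_slope lh2.
have b1 : bborel (fun z => 1 - slope f z) by apply: bborelB => //; exact: bborelC.
(* The right-hand integrand is 1 - slope(c): nonnegative everywhere, and equal to 1 where [D z = 1],
   since c is bounded. *)
have : intR mu (\1_[set z | D z = 1] : K -> R) <= intR mu (fun z => slope h z + (1 - slope f z)).
  apply: (intR_le fin); [exact: bborel_indic|exact: bborelD|].
  move=> z; rewrite indicE; have [D1|D1] := pselect (D z = 1).
    rewrite mem_set// sh.
    have := slope_ratio dm sc uc cp1 cp2 pE PhiP z cD DE lc cB.
    by rewrite D1 subrr mul1r mul0r => -> /=; lra.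
  by rewrite memNset//= sh; have := slope_le dm sc PhiP z lc; lra.
by move=> /le_trans; apply; rewrite (intRD fin bsh b1) [e]splitr lerD// (le_trans Ih).
Qed.

End OptimalRepresentation.

(** * Concentration where both limit cutoffs vanish *)

Section Concentration.
Context {R : realType} {T : Type} {d : T -> T -> R} {x0 : T}
  {K : ptopologicalType} {iota : T -> T -> K} {U : ptopologicalType} {j : T -> U}
  {p1 p2 : K -> U} {Phi : (T -> R) -> K -> R}.
Hypotheses (dm : is_metric d) (sc : is_stone_cech_tilde d iota)
  (uc : is_uniform_compactification d j).
Hypotheses (cp1 : continuous p1) (cp2 : continuous p2).
Hypothesis pE : forall x y, x <> y -> p1 (iota x y) = j x /\ p2 (iota x y) = j y.
Hypothesis PhiP : forall f, Lip0 d x0 f ->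
     continuous (Phi f) /\
     forall x y, x <> y -> Phi f (iota x y) = (f x - f y) / d x y.
Variable mu : {measure set (borel K) -> \bar R}.
Hypotheses (rmu : radon mu) (mumin : preceq_minimal d iota mu).
Hypothesis T3 : exists a b c : T, [/\ a <> b, b <> c & a <> c].
Variable D : K -> R.
Hypotheses (cD : continuous D)
  (DE : forall x y, x <> y -> D (iota x y) = d x y / (1 + d x y)).
Variable l : nat -> seq T.
Implicit Types f h k : T -> R.

Local Notation slope := (@slope R T x0 K Phi).
Local Notation fst_ext := (@fst_ext R T K U j p1).
Local Notation snd_ext := (@snd_ext R T K U j p2).
Local Notation inv_dist := (@inv_dist R K D).
Local Notation w := (fun n => @trunc_dist R T d (l n)).

Hypothesis l_decr : forall n x, w n.+1 x <= w n x.
Hypothesis l_small : forall n C f, 0 < C -> lip d C f ->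
  (forall x, w n x = 0 -> f x = 0) -> `|intR mu (slope f)| <= C / n.+1%:R.

Let cK : compact [set: K]. Proof. by case: sc. Qed.
Let fin : (mu setT < +oo)%E. Proof. by case: rmu. Qed.
Let M := fine (mu setT).
Let M0 : 0 <= M. Proof. exact: fine_ge0. Qed.

Let lw n : lip d 1 (w n). Proof. exact: trunc_dist_lip. Qed.
Let wB n x : `|w n x| <= 1. Proof. exact: norm_le1_01 (trunc_dist01 dm _ _). Qed.

Let W1n n : K -> R := fst_ext (w n).
Let W2n n : K -> R := snd_ext (w n).

Let W1n_cts n : continuous (W1n n). Proof. exact: (fst_ext_cts dm uc cp1 (lw n) (@wB n)). Qed.
Let W2n_cts n : continuous (W2n n). Proof. exact: (snd_ext_cts dm uc cp2 (lw n) (@wB n)). Qed.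

Let Wn01 n z : (0 <= W1n n z <= 1) /\ (0 <= W2n n z <= 1).
Proof. exact: (ext_bounds dm uc z (lw n) (@wB n) (trunc_dist01 dm (l n))). Qed.

Definition fst_limit (z : K) : R := inf [set fst_ext (w n) z | n in setT].
Definition snd_limit (z : K) : R := inf [set snd_ext (w n) z | n in setT].

Local Notation W1 := fst_limit.
Local Notation W2 := snd_limit.

Let W1_cvg z : (fun n => W1n n z) @ \oo --> W1 z.
Proof.
apply: (@nonincreasing_cvgn R (fun n => W1n n z)).
  apply/nonincreasing_seqP => n.
  exact: (fst_ext_le dm uc z (lw n.+1) (@wB n.+1) (lw n) (@wB n) (l_decr n)).
by exists 0 => _ [n _ <-]; have [/andP[]] := Wn01 n z.
Qed.

Let W2_cvg z : (fun n => W2n n z) @ \oo --> W2 z.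
Proof.
apply: (@nonincreasing_cvgn R (fun n => W2n n z)).
  apply/nonincreasing_seqP => n.
  exact: (snd_ext_le dm uc z (lw n.+1) (@wB n.+1) (lw n) (@wB n) (l_decr n)).
by exists 0 => _ [n _ <-]; have [_ /andP[]] := Wn01 n z.
Qed.

Let lim_01 (u : nat -> R) a : (forall n, 0 <= u n <= 1) -> u @ \oo --> a -> 0 <= a <= 1.
Proof.
move=> u01 ua; apply/andP; split.
  by apply: (ler_cvg_to (@cvg_cst _ (0 : R) _ _ _) ua); apply: nearW => n; have /andP[] := u01 n.
by apply: (ler_cvg_to ua (@cvg_cst _ (1 : R) _ _ _)); apply: nearW => n; have /andP[] := u01 n.
Qed.

Let W1_01 z : 0 <= W1 z <= 1.
Proof. exact (lim_01 (fun n => proj1 (Wn01 n z)) (@W1_cvg z)). Qed.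

Let W2_01 z : 0 <= W2 z <= 1.
Proof. exact (lim_01 (fun n => proj2 (Wn01 n z)) (@W2_cvg z)). Qed.

Lemma fst_limit_bborel : bborel W1.
Proof.
apply: (@bborel_lim _ _ W1n _ 1) => [n|n x|]; first exact: bborel_cts.
  by apply: norm_le1_01; have [] := Wn01 n x.
exact: W1_cvg.
Qed.

Lemma snd_limit_bborel : bborel W2.
Proof.
apply: (@bborel_lim _ _ W2n _ 1) => [n|n x|]; first exact: bborel_cts.
  by apply: norm_le1_01; have [] := Wn01 n x.
exact: W2_cvg.
Qed.

Let bW1 := fst_limit_bborel.
Let bW2 := snd_limit_bborel.

Let m z := (W1 z * W1 z + W2 z * W2 z) / 2.
Let mn n z := (W1n n z * W1n n z + W2n n z * W2n n z) / 2.

Let bm : bborel m.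
Proof. by apply: bborelM; [apply: bborelD; exact: bborelM|exact: bborelC]. Qed.

Let bmn n : bborel (mn n).
Proof.
apply: bborel_cts => //; apply: ctsM; last exact: ctsC.
by apply: ctsD; apply: ctsM.
Qed.

Let m01 z : 0 <= m z <= 1.
Proof.
have /andP[? ?] := W1_01 z; have /andP[? ?] := W2_01 z.
by rewrite /m; apply/andP; split; nra.
Qed.

Let mn01 n z : 0 <= mn n z <= 1.
Proof.
have [/andP[? ?] /andP[? ?]] := Wn01 n z.
by rewrite /mn; apply/andP; split; nra.
Qed.

Let mn_cvg z : (fun n => mn n z) @ \oo --> m z.
Proof.
apply: cvgM; last exact: cvg_cst.
by apply: cvgD; apply: cvgM.
Qed.

Let m_eq0 z : m z = 0 -> W1 z = 0 /\ W2 z = 0.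
Proof.
by have /andP[? ?] := W1_01 z; have /andP[? ?] := W2_01 z; rewrite /m => h; split; nra.
Qed.

Let kn n (x : T) : R := w n x * w n x.

Let lk n : lip d (1 * 1 + 1 * 1) (kn n).
Proof. exact: (lipM (lw n) (lw n) (@wB n) (@wB n)). Qed.

Let kB n x : `|kn n x| <= 1.
Proof. by rewrite /kn normrM mulr_ile1. Qed.

(** This is the gain from squaring: the slope of w_n alone is only bounded by 1, whereas this bound
    tends to 0 where W1 = W2 = 0. *)
Let slope_kn n z : `|slope (kn n) z| <= W1n n z + W2n n z.
Proof.
have e : 2 * slope (kn n) z = (W1n n z + W2n n z) * slope (w n) z + (W1n n z + W2n n z) * slope (w n) z
  := slope_mul dm sc uc cp1 cp2 pE PhiP z (lw n) (@wB n) (lw n) (@wB n).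
have /andP[] : -1 <= slope (w n) z <= 1.
  by rewrite -ler_norml; exact: (slope_norm dm sc PhiP z (lw n)).
have [/andP[? ?] /andP[? ?]] := Wn01 n z.
by move: e; move: (slope (w n) z) (slope (kn n) z) => s t *; rewrite ler_norml; apply/andP; split; nra.
Qed.

(** * Lower bounds for int m slope(h) over test functions h *)

Section TestFunction.
Variables (C : R) (h : T -> R).
Hypotheses (lh : lip d C h) (h10 : forall x, -1 <= h x <= 0).

Let hB x : `|h x| <= 1.
Proof. by have /andP[? ?] := h10 x; rewrite ler_norml; apply/andP; split; lra. Qed.

Let h1 := fst_ext h.
Let h2 := snd_ext h.

Let h1_cts : continuous h1. Proof. exact: (fst_ext_cts dm uc cp1 lh hB). Qed.
Let h2_cts : continuous h2. Proof. exact: (snd_ext_cts dm uc cp2 lh hB). Qed.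

Let h12 z : (-1 <= h1 z <= 0) /\ (-1 <= h2 z <= 0).
Proof. exact: (ext_bounds dm uc z lh hB h10). Qed.

(** A positive Lipschitz constant for w_n^2 h: the product rule gives C + 2, as w_n^2 has constant 2
    and both factors are bounded by 1. *)
Let E := `|C| + 3.
Let E0 : 0 < E. Proof. by rewrite ltr_wpDl. Qed.

Let kh n x := kn n x * h x.

Let lkh n : lip d E (kh n).
Proof.
apply: (lip_weaken dm _ (lipM (lk n) lh (@kB n) hB)).
by have := ler_norm C; rewrite /E; lra.
Qed.

Let Ikh n : `|intR mu (slope (kh n))| <= E / n.+1%:R.
Proof. by apply: l_small => // x w0; rewrite /kh /kn w0 !mul0r. Qed.

Let kh_identity n z : slope (kh n) z =
  mn n z * slope h z + (h1 z + h2 z) / 2 * slope (kn n) z.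
Proof.
have e : 2 * slope (kh n) z = (fst_ext (kn n) z + snd_ext (kn n) z) * slope h z +
    (h1 z + h2 z) * slope (kn n) z := slope_mul dm sc uc cp1 cp2 pE PhiP z lh hB (lk n) (@kB n).
have [e1 e2] : fst_ext (kn n) z = W1n n z * W1n n z /\ snd_ext (kn n) z = W2n n z * W2n n z.
  exact: (ext_mul dm uc z (lw n) (@wB n) (lw n) (@wB n)).
rewrite e1 e2 in e; have n2 : (2 : R) != 0 by rewrite pnatr_eq0.
apply: (mulfI n2).
by rewrite e /mn /W1n /W2n; field.
Qed.

Let bsh : bborel (slope h). Proof. by apply: bborel_cts => //; exact: (slope_cts PhiP lh). Qed.
Let bskh n : bborel (slope (kh n)). Proof. by apply: bborel_cts => //; exact: (slope_cts PhiP (lkh n)). Qed.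

Let slope_h_norm z : `|slope h z| <= `|C|.
Proof. by rewrite (le_trans (slope_norm dm sc PhiP z lh))// ler_norm. Qed.

Let E_cvg : (fun n => E / n.+1%:R) @ \oo --> (0 : R).
Proof.
rewrite -(mulr0 E); apply: cvgM; first exact: cvg_cst.
exact: cvg_harmonic.
Qed.

(** In [kh_identity] the left side integrates to at most E/(n+1) in absolute value, and the last
    term is pointwise at most 2. The dependence on C disappears in the limit, so the bound is
    uniform over all test functions. *)
Lemma integral_m_slope_ge : - (2 * M) <= intR mu (fun z => m z * slope h z).
Proof.
have lim1 : (fun n => intR mu (fun z => mn n z * slope h z)) @ \oo -->
    intR mu (fun z => m z * slope h z).
  apply: (@intR_bounded_cvg _ _ _ fin _ _ `|C|) => [n|n z|z].
  - exact: bborelM.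
  - rewrite normrM -[X in _ <= X]mul1r ler_pM//.
    exact: norm_le1_01 (mn01 n z).
  - by apply: cvgM; [exact: mn_cvg|exact: cvg_cst].
have lim2 : (fun n => - (E / n.+1%:R) - 2 * M) @ \oo --> - (2 * M).
  rewrite -[X in _ --> X]add0r -[X in X - _]oppr0.
  by apply: cvgB; [exact: cvgN|exact: cvg_cst].
apply: (ler_cvg_to lim2 lim1); apply: nearW => n.
have bh12 : bborel (fun z => (h1 z + h2 z) / 2 * slope (kn n) z).
  apply: bborel_cts => //; apply: ctsM; last exact: (slope_cts PhiP (lk n)).
  by apply: ctsM; [exact: ctsD|exact: ctsC].
have -> : (fun z => mn n z * slope h z) =
    (fun z => slope (kh n) z - (h1 z + h2 z) / 2 * slope (kn n) z).
  by apply/funext => z; rewrite kh_identity addrK.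
rewrite (intRB fin)//.
have := Ikh n; rewrite ler_norml => /andP[+ _]; move: (E / n.+1%:R) => q hq.
have : `|intR mu (fun z => (h1 z + h2 z) / 2 * slope (kn n) z)| <= 2 * M.
  apply: (intR_norm_le fin) => // z.
  have := slope_kn n z; have [/andP[? ?] /andP[? ?]] := Wn01 n z.
  have [/andP[? ?] /andP[? ?]] := h12 z.
  rewrite normrM => hk; rewrite -[X in _ <= X]mul1r ler_pM//; last by lra.
  by rewrite ler_norml; apply/andP; split; lra.
by rewrite ler_norml => /andP[? ?]; lra.
Qed.

Let ratio0 z : 0 <= D z. Proof. exact: (ratio_ge0 dm sc cD DE). Qed.
Let ratio1 z : D z <= 1. Proof. exact: (ratio_le1 dm sc cD DE). Qed.

(* Where D vanishes the coefficient is 1 / 0 = 0. *)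
Let flux z := (1 - D z) / D z * (W1 z * W1 z * h1 z - W2 z * W2 z * h2 z).

Variable N : set (borel K).
Hypotheses (mN : measurable N) (N0 : mu N = 0%E) (ND : forall z, N z -> D z = 0)
  (Nm : forall z, ~ N z -> D z = 0 -> m z = 0).

Let bNc : bborel (\1_(~` N) : K -> R).
Proof. by apply: bborel_indic; exact: measurableC. Qed.

Let indicN z : N z -> (\1_(~` N) z : R) = 0.
Proof. by move=> Nz; rewrite indicE memNset//= => /(_ Nz). Qed.

Let indicNc z : ~ N z -> (\1_(~` N) z : R) = 1.
Proof. by move=> Nz; rewrite indicE mem_set. Qed.

Let slope_kh_off n z : D z != 0 -> slope (kh n) z =
  (1 - D z) / D z * (W1n n z * W1n n z * h1 z - W2n n z * W2n n z * h2 z).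
Proof.
move=> Dz; have khB x : `|kh n x| <= 1 by rewrite /kh normrM mulr_ile1.
have e : D z * slope (kh n) z = (1 - D z) * (fst_ext (kh n) z - snd_ext (kh n) z)
  := slope_ratio dm sc uc cp1 cp2 pE PhiP z cD DE (lkh n) khB.
have [e1 e2] : fst_ext (kn n) z = W1n n z * W1n n z /\ snd_ext (kn n) z = W2n n z * W2n n z.
  exact: (ext_mul dm uc z (lw n) (@wB n) (lw n) (@wB n)).
have [e3 e4] : fst_ext (kh n) z = fst_ext (kn n) z * h1 z /\ snd_ext (kh n) z = snd_ext (kn n) z * h2 z.
  exact: (ext_mul dm uc z lh hB (lk n) (@kB n)).
by apply: (mulfI Dz); rewrite e e3 e4 e1 e2; field.
Qed.

(** Where [D z != 0] the quotient formula for the slope passes to the limit. On [N] both sides are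
    0. At [D z = 0] off [N], W1 = W2 = 0 and the Leibniz rule squeezes the slope to 0. *)
Let flux_cvg z : (fun n => slope (kh n) z * \1_(~` N) z) @ \oo --> flux z.
Proof.
have [Dz|Dz] := eqVneq (D z) 0; last first.
  have Nz : ~ N z by move=> /ND Dz0; move: Dz; rewrite Dz0 eqxx.
  rewrite indicNc//; under eq_fun do rewrite mulr1 slope_kh_off//.
  apply: cvgM; first exact: cvg_cst.
  by apply: cvgB; (apply: cvgM; last exact: cvg_cst); exact: cvgM.
rewrite /flux Dz invr0 mulr0 mul0r.
have [Nz|Nz] := pselect (N z).
  by rewrite indicN//; under eq_fun do rewrite mulr0; exact: cvg_cst.
rewrite indicNc//; under eq_fun do rewrite mulr1.
have [W1z W2z] := m_eq0 (Nm Nz Dz).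
have lim0 : (fun n => mn n z * `|C| + (W1n n z + W2n n z)) @ \oo --> (0 : R).
  have -> : 0 = m z * `|C| + (W1 z + W2 z) by rewrite (Nm Nz Dz) W1z W2z mul0r !addr0.
  apply: cvgD; last exact: cvgD.
  by apply: cvgM; [exact: mn_cvg|exact: cvg_cst].
have lim0' : (fun n => - (mn n z * `|C| + (W1n n z + W2n n z))) @ \oo --> (0 : R).
  by rewrite -oppr0; exact: cvgN.
apply: (squeeze_cvgr _ lim0' lim0); apply: nearW => n; rewrite -ler_norml.
rewrite kh_identity (le_trans (ler_normD _ _))// lerD//.
  by rewrite normrM (ger0_norm (proj1 (andP (mn01 n z)))) ler_wpM2l//; have /andP[] := mn01 n z.
have [/andP[? ?] /andP[? ?]] := h12 z.
rewrite normrM -[X in _ <= X]mul1r ler_pM//.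
by rewrite ler_norml; apply/andP; split; lra.
Qed.

Let bF n : bborel (fun z => slope (kh n) z * \1_(~` N) z).
Proof. exact: bborelM. Qed.

Let F_norm n z : `|slope (kh n) z * \1_(~` N) z| <= E.
Proof.
rewrite normrM -[X in _ <= X]mulr1 ler_pM//; first exact: (slope_norm dm sc PhiP z (lkh n)).
by rewrite indicE; case: (_ \in _); rewrite ?normr1 ?normr0.
Qed.

Let bflux : bborel flux.
Proof. exact: (bborel_lim bF F_norm flux_cvg). Qed.

(** The approximants are bounded by E, and their integrals by E/(n+1) because [N] is null. *)
Let integral_flux : intR mu flux = 0.
Proof.
have lim := intR_bounded_cvg fin bF F_norm flux_cvg.
have IF n : `|intR mu (fun z => slope (kh n) z * \1_(~` N) z)| <= E / n.+1%:R.
  rewrite (@intR_eq_ae _ _ _ fin _ (slope (kh n)) N)// => z Nz.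
  by rewrite indicNc// mulr1.
apply/eqP; rewrite eq_le; apply/andP; split.
  apply: (ler_cvg_to lim E_cvg); apply: nearW => n.
  exact: le_trans (ler_norm _) (IF n).
have E_cvg' : (fun n => - (E / n.+1%:R)) @ \oo --> (0 : R) by rewrite -oppr0; exact: cvgN.
apply: (ler_cvg_to E_cvg' lim); apply: nearW => n.
by have := IF n; rewrite ler_norml => /andP[].
Qed.

Lemma flux_integral : bborel (fun z =>
    (1 - D z) / D z * (W1 z * W1 z * fst_ext h z - W2 z * W2 z * snd_ext h z)) /\
  intR mu (fun z =>
    (1 - D z) / D z * (W1 z * W1 z * fst_ext h z - W2 z * W2 z * snd_ext h z)) = 0.
Proof. by split; [exact: bflux|exact: integral_flux]. Qed.

(** As the flux integrates to 0, - int m slope(h) is the integral of F = flux / 2 - m slope(h).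
    Where [D z != 0], F = (W1^2 h2 - W2^2 h1) / (2 d), which is at most W2^2 / (2 d) because h2 <= 0
    and h1 >= -1. *)
Lemma integral_m_slope_ge_snd c :
  (forall a, 0 < a -> intR mu (fun z => W2 z * W2 z / 2 * inv_dist a z) <= c) ->
  - c <= intR mu (fun z => m z * slope h z).
Proof.
move=> hc; pose F z := flux z / 2 - m z * slope h z.
have bms : bborel (fun z => m z * slope h z) by exact: bborelM.
have bfl2 : bborel (fun z => 2^-1 * flux z) by apply: bborelM => //; exact: bborelC.
have IF : intR mu F = - intR mu (fun z => m z * slope h z).
  have -> : F = (fun z => 2^-1 * flux z - m z * slope h z).
    by apply/funext => z; rewrite /F [flux z / 2]mulrC.
  by rewrite (intRB fin)// (intRZ fin)// integral_flux mulr0 sub0r.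
have bFF : bborel F.
  by apply: bborelB => //; apply: bborelM => //; exact: bborelC.
pose F' z := F z * \1_(~` N) z.
have bF' : bborel F' by exact: bborelM.
have -> : intR mu (fun z => m z * slope h z) = - intR mu F'.
  rewrite (@intR_eq_ae _ _ _ fin F' F N)// ?IF ?opprK// => z Nz.
  by rewrite /F' indicNc// mulr1.
rewrite lerN2.
pose g (n : nat) z := W2 z * W2 z / 2 * inv_dist n.+1%:R^-1 z.
have ip n : 0 < n.+1%:R^-1 :> R by rewrite invr_gt0.
have g0 n z : 0 <= g n z.
  have /andP[? ?] := W2_01 z.
  by rewrite /g mulr_ge0 ?(inv_dist_ge0 dm sc cD DE)// divr_ge0// mulr_ge0.
have bg n : bborel (g n).
  apply: bborelM; first by apply: bborelM; [exact: bborelM|exact: bborelC].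
  by apply: bborel_cts => //; exact: (inv_dist_cts dm sc cD DE).
have [_ [B hBB]] := bF'.
(* The limit of [g n] may be unbounded. The minimum with the bounded F' stays bounded, since
   [g n >= 0], and tends to F', so dominated convergence applies. *)
pose G n z := Num.min (F' z) (g n z).
have bG n : bborel (G n) by exact: bborel_min.
have GB n z : `|G n z| <= B.
  have := hBB z; have := g0 n z; rewrite /G !ler_norml => ? /andP[? ?].
  by case: (leP (F' z) (g n z)) => ?; apply/andP; split; lra.
have Gcvg z : (fun n => G n z) @ \oo --> F' z.
  have [Dz|Dz] := eqVneq (D z) 0.
    have F'0 : F' z = 0.
      rewrite /F' /F /flux Dz invr0 mulr0 mul0r mul0r sub0r.
      have [Nz|Nz] := pselect (N z); first by rewrite indicN// mulr0.
      by rewrite (Nm Nz Dz) mul0r oppr0 mul0r.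
    rewrite /G F'0; under eq_fun do rewrite min_l//; exact: cvg_cst.
  have Nz : ~ N z by move=> /ND Dz0; move: Dz; rewrite Dz0 eqxx.
  have gcvg : (fun n => g n z) @ \oo --> W2 z * W2 z / 2 * ((1 - D z) / D z).
    by apply: cvgM; [exact: cvg_cst|exact: inv_dist_cvg].
  have Fle : F' z <= W2 z * W2 z / 2 * ((1 - D z) / D z).
    have sE : slope h z = (1 - D z) / D z * (h1 z - h2 z).
      have e : D z * slope h z = (1 - D z) * (h1 z - h2 z)
        := slope_ratio dm sc uc cp1 cp2 pE PhiP z cD DE lh hB.
      by apply: (mulfI Dz); rewrite e; field.
    rewrite /F' indicNc// mulr1 /F /flux sE /m.
    have e0 : 0 <= (1 - D z) / D z by rewrite divr_ge0// subr_ge0.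
    move: ((1 - D z) / D z) e0 => e e0.
    have [/andP[? ?] /andP[? ?]] := h12 z.
    have W10 := sqr_ge0 (W1 z); have W20 := sqr_ge0 (W2 z); rewrite !expr2 in W10 W20.
    move: (W1 z * W1 z) (W2 z * W2 z) W10 W20 => a b a0 b0.
    have -> : e * (a * h1 z - b * h2 z) / 2 - (a + b) / 2 * (e * (h1 z - h2 z)) =
        e / 2 * (a * h2 z - b * h1 z) by field.
    have -> : b / 2 * e = e / 2 * b by ring.
    by apply: ler_wpM2l; [rewrite divr_ge0|nra].
  (* The limit of the minimum is taken through min(a, b) = (a + b - |a - b|) / 2. *)
  have -> : F' z = (F' z + W2 z * W2 z / 2 * ((1 - D z) / D z) -
      `|F' z - W2 z * W2 z / 2 * ((1 - D z) / D z)|) / 2.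
    by rewrite -minr_absE min_l.
  rewrite /G; under eq_fun do rewrite minr_absE.
  apply: cvgM; last exact: cvg_cst.
  apply: cvgB; first by apply: cvgD => //; exact: cvg_cst.
  by apply: cvg_norm; apply: cvgB => //; exact: cvg_cst.
have lim := intR_bounded_cvg fin bG GB Gcvg.
apply: (ler_cvg_to lim (@cvg_cst _ c _ _ _)); apply: nearW => n.
apply: le_trans (hc _ (ip n)); apply: (intR_le fin); [exact: bG|exact: bg|move=> z].
by rewrite /G ge_min lexx orbT.
Qed.

End TestFunction.

Let bound a : 0 < a -> intR mu (fun z => m z * inv_dist a z) <= 2 * M.
Proof.
move=> a0; apply: (minimal_Gset_bound dm sc PhiP rmu mumin T3) => //.
- exact: (inv_dist_Gset dm sc cD DE).
- by move=> x y xy; exact: (dist_inv_dist_le1 dm DE).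
- exact: integral_m_slope_ge.
Qed.

Let bW11 : bborel (fun z => W1 z * W1 z / 2).
Proof. by apply: bborelM; [exact: bborelM|exact: bborelC]. Qed.

Let bW22 : bborel (fun z => W2 z * W2 z / 2).
Proof. by apply: bborelM; [exact: bborelM|exact: bborelC]. Qed.

Let binv a : 0 < a -> bborel (inv_dist a).
Proof. by move=> a0; apply: bborel_cts => //; exact: (inv_dist_cts dm sc cD DE). Qed.

Let inv0 a z : 0 < a -> 0 <= inv_dist a z.
Proof. exact: (inv_dist_ge0 dm sc cD DE). Qed.

Let W11_0 z : 0 <= W1 z * W1 z / 2.
Proof. by have := sqr_ge0 (W1 z); rewrite expr2; lra. Qed.

Let W22_0 z : 0 <= W2 z * W2 z / 2.
Proof. by have := sqr_ge0 (W2 z); rewrite expr2; lra. Qed.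

(** Where [D z = 0], [inv_dist a] equals 1 / a. The bound 2 M, uniform in a, then gives at most 2 M
    a for the integral of m over {D = 0}, for every a > 0. *)
Let ratio0_null : exists N : set (borel K), [/\ measurable N, mu N = 0%E,
  forall z, N z -> D z = 0 & forall z, ~ N z -> D z = 0 -> m z = 0].
Proof.
have mD0 : measurable ([set z | D z = 0] : set (borel K)).
  by apply: closed_borel; exact: cts_closed_eq.
have bD0 := @bborel_indic R K _ mD0.
pose f z := m z * \1_[set z | D z = 0] z.
have f0 z : 0 <= f z.
  have /andP[? _] := m01 z.
  by rewrite mulr_ge0// indicE; case: (_ \in _).
have bf : bborel f by exact: bborelM.
have If : intR mu f <= 0.
  apply/ler_addgt0Pr => e e0; rewrite add0r.
  have M1 : 0 < 2 * M + 1 by rewrite ltr_wpDl// mulr_ge0.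
  pose a := e / (2 * M + 1); have a0 : 0 < a by exact: divr_gt0.
  have bmi : bborel (fun z => m z * inv_dist a z) by apply: bborelM => //; exact: binv.
  apply: (@le_trans _ _ (intR mu (fun z => a * (m z * inv_dist a z)))).
    apply: (intR_le fin) => //; first by apply: bborelM => //; exact: bborelC.
    move=> z; have /andP[m0 _] := m01 z.
    rewrite /f indicE; have [Dz|Dz] := pselect (D z = 0).
      by rewrite mem_set//= mulr1 inv_dist_at0// mulrCA divff ?mulr1// gt_eqF.
    rewrite memNset//= mulr0; apply: mulr_ge0; first exact: ltW.
    by apply: mulr_ge0 => //; exact: inv0.
  rewrite (intRZ fin)//; have /(ler_wpM2l (ltW a0)) := bound a0.
  move=> /le_trans; apply; rewrite /a mulrAC ler_pdivrMr// ler_pM2l//.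
  by rewrite lerDl.
have [mN N0] := intR_eq0_null fin bf f0 If.
exists [set z | f z != 0]; split=> // z /=; rewrite /f indicE.
  have [//|Dz] := pselect (D z = 0).
  by rewrite memNset// mulr0 eqxx.
by move=> + Dz; rewrite mem_set// mulr1 => /negP; rewrite negbK => /eqP.
Qed.

Hypothesis D1_null : mu [set z | D z = 1] = 0%E.

Lemma limits_vanish_ae : exists B : set (borel K),
  [/\ measurable B, mu (~` B) = 0%E & forall z, B z -> W1 z = 0 /\ W2 z = 0].
Proof.
have [N [mN N0 ND Nm]] := ratio0_null.
(* This plays the role of int W2^2 / (2 d); the supremum is finite by the crude bound 2 M. *)
pose c2 := sup [set intR mu (fun z => W2 z * W2 z / 2 * inv_dist a z) | a in [set a | 0 < a]].
have bg a : 0 < a -> bborel (fun z => W2 z * W2 z / 2 * inv_dist a z).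
  by move=> a0; apply: bborelM => //; exact: binv.
have bg1 a : 0 < a -> bborel (fun z => W1 z * W1 z / 2 * inv_dist a z).
  by move=> a0; apply: bborelM => //; exact: binv.
have Im a : 0 < a -> intR mu (fun z => m z * inv_dist a z) =
    intR mu (fun z => W1 z * W1 z / 2 * inv_dist a z) +
    intR mu (fun z => W2 z * W2 z / 2 * inv_dist a z).
  move=> a0; rewrite -(intRD fin (bg1 a a0) (bg a a0)); congr intR.
  by apply/funext => z; rewrite /m; ring.
have I1_0 a : 0 < a -> 0 <= intR mu (fun z => W1 z * W1 z / 2 * inv_dist a z).
  by move=> a0; apply: intR_ge0 => z; rewrite mulr_ge0// inv0.
have supc : has_sup [set intR mu (fun z => W2 z * W2 z / 2 * inv_dist a z) | a in [set a | 0 < a]].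
  split; first by eexists; exists 1 => //=; exact: ltr01.
  exists (2 * M) => _ [a a0 <-].
  by have := bound a0; rewrite Im//; have := I1_0 _ a0; lra.
have hc2 a : 0 < a -> intR mu (fun z => W2 z * W2 z / 2 * inv_dist a z) <= c2.
  by move=> a0; apply: ub_le_sup; [exact: supc.2|exists a].
have bound2 a : 0 < a -> intR mu (fun z => m z * inv_dist a z) <= c2.
  move=> a0; apply: (minimal_Gset_bound dm sc PhiP rmu mumin T3) => //.
  - exact: (inv_dist_Gset dm sc cD DE).
  - by move=> x y xy; exact: (dist_inv_dist_le1 dm DE).
  - by move=> C h lh h10; exact: (integral_m_slope_ge_snd lh h10 mN N0 ND Nm).
(* The W1 and W2 parts add up to at most [c2], and for some a the W2 part exceeds [c2 - e], so the
   W1 part is below e. Replacing a by min(a, 1) only increases both parts and allows the comparison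
   with [inv_dist 1]. *)
have I1 : intR mu (fun z => W1 z * W1 z / 2 * inv_dist 1 z) <= 0.
  apply/ler_addgt0Pr => e e0; rewrite add0r.
  have [_ [a a0 <-] ha] := sup_adherent e0 supc.
  have a1 : 0 < Num.min a 1 by rewrite lt_min; apply/andP; split.
  apply: (@le_trans _ _ (intR mu (fun z => W1 z * W1 z / 2 * inv_dist (Num.min a 1) z))).
    apply: (intR_le fin); [exact: bg1|exact: bg1|move=> z].
    apply: ler_wpM2l => //; apply: (inv_dist_anti dm sc cD DE) => //.
    by rewrite ge_min lexx orbT.
  have : intR mu (fun z => W2 z * W2 z / 2 * inv_dist a z) <=
      intR mu (fun z => W2 z * W2 z / 2 * inv_dist (Num.min a 1) z).
    apply: (intR_le fin); [exact: bg|exact: bg|move=> z].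
    apply: ler_wpM2l => //; apply: (inv_dist_anti dm sc cD DE) => //.
    by rewrite ge_min lexx.
  have := bound2 _ a1; rewrite Im//; move: ha; rewrite -/c2; lra.
have [mN1 N10] := intR_eq0_null fin (bg1 _ ltr01) (fun z => mulr_ge0 (W11_0 z) (inv0 z ltr01)) I1.
set N1 := [set z | W1 z * W1 z / 2 * inv_dist 1 z != 0] in mN1 N10.
have mD1 : measurable ([set z | D z = 1] : set (borel K)).
  by apply: closed_borel; exact: cts_closed_eq.
have nullU (A B : set (borel K)) : measurable A -> measurable B -> mu A = 0%E -> mu B = 0%E ->
    measurable (A `|` B) /\ mu (A `|` B) = 0%E.
  by move=> mA mB A0 B0; split; [exact: measurableU|rewrite null_set_setU].
have [mNN1 NN10] := nullU _ _ mN mN1 N0 N10.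
have [mNN NN0] := nullU _ _ mNN1 mD1 NN10 D1_null.
have lm1 : lip d 0 (fun _ : T => -1) by exact: (lip_cst dm).
have m10 (x : T) : -1 <= (-1 : R) <= 0 by rewrite lexx lerN10.
have [bfl Ifl] := flux_integral lm1 m10 mN N0 ND Nm.
have ext1 z : fst_ext (fun=> -1) z = -1 /\ snd_ext (fun=> -1) z = -1.
  have [] : (-1 <= fst_ext (fun=> -1) z <= -1) /\ (-1 <= snd_ext (fun=> -1) z <= -1).
    apply: (ext_bounds dm uc z lm1 (B := 1)) => x; last by rewrite lexx.
    by rewrite normrN1.
  by move=> /andP[? ?] /andP[? ?]; split; apply/eqP; rewrite eq_le; apply/andP; split.
(* For h = -1 the flux is (W2^2 - W1^2) (1 - D) / D. Almost everywhere W1 = 0, and D <= 1 makes it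
   dominate W2^2 (1 - D) / 2. *)
have I2 : intR mu (fun z => W2 z * W2 z / 2 * inv_dist 1 z) <= 0.
  rewrite -Ifl; apply: (intR_le_ae fin (bg _ ltr01) bfl mNN NN0) => z nN.
  have [e1 e2] := ext1 z; rewrite e1 e2 inv_dist1.
  have D1 : D z != 1 by apply/eqP => D1; apply: nN; right.
  have Dp : 0 < 1 - D z.
    by rewrite subr_gt0 lt_neqAle D1; exact: (ratio_le1 dm sc cD DE).
  have W1z : W1 z = 0.
    apply/eqP; apply/negP => /negP W1z; apply: nN; left; right.
    by rewrite /N1 /= inv_dist1 !mulf_neq0 ?invr_eq0 ?pnatr_eq0// gt_eqF.
  have [Dz|Dz] := eqVneq (D z) 0.
    have nNz : ~ N z by move=> Nz; apply: nN; left; left.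
    have [_ ->] := m_eq0 (Nm _ nNz Dz).
    by rewrite W1z !mul0r subr0 mulr0.
  have D0 : 0 < D z by rewrite lt_neqAle eq_sym Dz; exact: (ratio_ge0 dm sc cD DE).
  have Di : 1 <= (D z)^-1 by rewrite invf_ge1//; exact: (ratio_le1 dm sc cD DE).
  have e12 : 1 - D z <= (1 - D z) / D z by rewrite ler_peMr// ltW.
  rewrite W1z !mul0r sub0r mulrN1 opprK [leRHS]mulrC.
  apply: le_trans (ler_wpM2l (W22_0 z) e12) _; apply: ler_wpM2r.
    exact: le_trans (ltW Dp) e12.
  rewrite ler_pdivrMr// ler_peMr ?ler1n//.
  by rewrite -expr2 sqr_ge0.
have [mN2 N20] := intR_eq0_null fin (bg _ ltr01) (fun z => mulr_ge0 (W22_0 z) (inv0 z ltr01)) I2.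
have [mA A0] := nullU _ _ mNN mN2 NN0 N20.
exists (~` (N `|` N1 `|` [set z | D z = 1] `|` [set z | W2 z * W2 z / 2 * inv_dist 1 z != 0])).
split; [exact: measurableC|by rewrite setCK|].
move=> z nz.
have D1 : D z != 1 by apply/eqP => D1; apply: nz; left; right.
have Dp : 1 - D z != 0 by rewrite subr_eq0 eq_sym.
split; apply/eqP; apply/negP => /negP Wz; apply: nz.
  by left; left; right; rewrite /N1 /= inv_dist1 !mulf_neq0 ?invr_eq0 ?pnatr_eq0.
by right; rewrite /= inv_dist1 !mulf_neq0 ?invr_eq0 ?pnatr_eq0.
Qed.

Hypothesis cM : complete_metric d.

(** For every e some cutoff is below e at [p1 z], which puts [p1 z] within e of a single point of a
    finite list; completeness does the rest. *)
Lemma fst_limit0 z : W1 z = 0 -> exists x, p1 z = j x.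
Proof.
move=> W1z; apply: (complete_point dm uc cM) => e e0 e1.
have [|_ [n _ <-]] := @inf_adherent R [set fst_ext (w n) z | n in setT] e e0.
  split; first by exists (fst_ext (w 0%N) z), 0%N.
  by exists 0 => _ [n _ <-]; have [/andP[]] :=
    ext_bounds (p1 := p1) (p2 := p1) dm uc z (lw n) (@wB n) (trunc_dist01 dm (l n)).
by rewrite -/(W1 z) W1z add0r => /(trunc_dist_small dm uc e1).
Qed.

Lemma snd_limit0 z : W2 z = 0 -> exists x, p2 z = j x.
Proof.
move=> W2z; apply: (complete_point dm uc cM) => e e0 e1.
have [|_ [n _ <-]] := @inf_adherent R [set snd_ext (w n) z | n in setT] e e0.
  split; first by exists (snd_ext (w 0%N) z), 0%N.
  by exists 0 => _ [n _ <-]; have [_ /andP[]] :=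
    ext_bounds (p1 := p2) (p2 := p2) dm uc z (lw n) (@wB n) (trunc_dist01 dm (l n)).
by rewrite -/(W2 z) W2z add0r => /(trunc_dist_small dm uc e1).
Qed.

End Concentration.

Unset Implicit Arguments.

Theorem theorem5p2 (R : realType) (T : Type) (d : T -> T -> R) (x0 : T)
  (K : ptopologicalType) (iota : T -> T -> K)
  (U : ptopologicalType) (j : T -> U)
  (p1 p2 : K -> U) (Phi : (T -> R) -> K -> R)
  (mu : {measure set (borel K) -> \bar R}) :
  is_metric d -> complete_metric d ->
  (exists a b c : T, [/\ a <> b, b <> c & a <> c]) ->
  is_stone_cech_tilde d iota ->
  is_uniform_compactification d j ->
  continuous p1 -> continuous p2 ->
  (forall x y, x <> y -> p1 (iota x y) = j x /\ p2 (iota x y) = j y) ->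
  (forall f, Lip0 d x0 f ->
     continuous (Phi f) /\
     forall x y, x <> y -> Phi f (iota x y) = (f x - f y) / d x y) ->
  radon mu ->
  (* optimal representation: ||mu|| = ||Phi^* mu|| *)
  mu [set: borel K] =
    ereal_sup [set r | exists2 f, Lip0_ball d x0 f & r = `| integ mu (Phi f) |%E] ->
  preceq_minimal d iota mu ->
  (* Phi^* mu lies in F(M), the norm closure of span {delta(x)} *)
  (forall e : R, 0 < e -> exists s : seq (R * T),
     forall f, Lip0_ball d x0 f ->
       (`| integ mu (Phi f) - (\sum_(ax <- s) ax.1 * f ax.2)%:E | <= e%:E)%E) ->
  (* mu is concentrated on p^{-1}(M x M) *)
  exists B : set (borel K),
    [/\ measurable B,
        (B : set K) `<=` [set z | exists x y, p1 z = j x /\ p2 z = j y] &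
        mu (~` B) = 0%E].
Proof.
move=> dm cM T3 sc uc cp1 cp2 pE PhiP rmu muopt mumin muF.
have [D [cD DE]] := exists_distance_ratio dm sc.
have [l [l_decr l0 l_small]] := free_space_cutoffs dm sc PhiP rmu muF.
have [_ D1] := ratio1_null dm sc uc cp1 cp2 pE PhiP rmu muF muopt cD DE.
have [B [mB B0 BW]] := limits_vanish_ae dm sc uc cp1 cp2 pE PhiP rmu mumin T3
  cD DE l_decr l_small D1.
exists B; split=> // z /BW[W1z W2z].
have [x p1z] := fst_limit0 dm uc cM W1z.
have [y p2z] := snd_limit0 dm uc cM W2z.
by exists x, y.
Qed.
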